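(* Let $S$ be a set of $n$ pairwise interior disjoint $x$-monotone curves inducing a planar subdivision. Let $\mathbb G$ be a history DAG of linear size that was constructed by a randomized incremental insertion of the curves of $S$. The expected running time of the recursive verification algorithm (described in the context) executed on $\mathbb G$ is $O(n\log n)$.
   Context: General position (standing assumption): no two distinct endpoints of curves have the same $x$-coordinate and no endpoint of one curve lies in the interior of another curve (curves may share endpoints). The trapezoidal map $\mathcal T(S)$ is obtained by extending a vertical wall from each endpoint upwards and downwards until it hits a curve of $S$ or goes to infinity; its faces are called trapezoids, considered open. History DAG $\mathbb G$ for an insertion order $cv_1,\dots,cv_n$ of $S$, with $S_i=\{cv_1,\dots,cv_i\}$: $\mathbb G_0$ is a single leaf (the whole plane). The leaves of $\mathbb G_i$ are the trapezoids of $\mathcal T(S_i)$. To pass from $\mathbb G_{i-1}$ to $\mathbb G_i$, let $p_i,q_i$ be the left and right endpoints of $cv_i$. Each leaf whose open trapezoid $\Delta$ is intersected by $cv_i$ is replaced by the following nodes, from top to bottom: if $p_i\in\Delta$, a point node $p_i$ whose left child is the leaf for the part of $\Delta$ left of $p_i$, and whose right child is the rest; then, if $q_i\in\Delta$, a point node $q_i$ whose right child is the leaf for the part of $\Delta$ right of $q_i$, and whose left child is the rest; then a curve node $cv_i$ with one child leaf for the part of the remaining piece above $cv_i$ and one for the part below $cv_i$. Finally, neighbouring new pieces that belong to the same trapezoid of $\mathcal T(S_i)$ (because the wall between them is now blocked by $cv_i$) are merged into one shared leaf. $\mathbb G=\mathbb G_n$. In a randomized incremental insertion the order is a uniformly random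 permutation of $S$; expectations are over this permutation. Recursive verification algorithm (it explores exactly the geometrically realizable search paths of $\mathbb G$ in order to determine whether the longest one has length at most $c\log n$ for a fixed constant $c$): it starts at the root with the interval $I=[-\infty,+\infty]$ of possible $x$-values. At a curve node it recurses into both children with $I$ unchanged. At a point node whose $x$-coordinate is contained in $I$, it recurses into the left and the right child with $I$ split at this $x$-coordinate into the left and the right subinterval, respectively. At a point node whose $x$-coordinate is not contained in $I$, it continues only to the one child that is on the side of the point containing $I$, with $I$ unchanged. At a leaf the recursion stops. Each visit to a node costs $O(1)$; a node may be visited several times. *)

(* Defs.v *)
(* MathComp + MathComp-Analysis. *)
From HB Require Import structures.
From mathcomp Require Import all_boot all_order all_algebra perm.
From mathcomp Require Import all_classical all_reals all_analysis.
Set Implicit Arguments.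
Unset Strict Implicit.
Unset Printing Implicit Defensive.
Import Order.TTheory GRing.Theory Num.Theory.
Import numFieldNormedType.Exports.
Local Open Scope classical_set_scope.
Local Open Scope ring_scope.

Section Curves.
Variable R : realType.

Local Notation plane := (R * R)%type.

(* A bounded x-monotone curve is the graph of a continuous function over a
   nondegenerate compact interval.  Vertical segments are left out: their two
   endpoints share an x-coordinate, which general position forbids. *)
Record curve := Curve {
  xl : R;
  xr : R;
  height : R -> R;
  xl_lt_xr : xl < xr;
  height_continuous : {within `[xl, xr], continuous height} }.

HB.instance Definition _ := gen_eqMixin curve.

Definition lpoint (c : curve) : plane := (xl c, height c (xl c)).
Definition rpoint (c : curve) : plane := (xr c, height c (xr c)).

Definition is_endpoint (c : curve) (e : plane) : Prop :=
  e = lpoint c \/ e = rpoint c.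

Definition graph (c : curve) : set plane :=
  [set z | xl c <= z.1 <= xr c /\ z.2 = height c z.1].

Definition curve_interior (c : curve) : set plane :=
  [set z | xl c < z.1 < xr c /\ z.2 = height c z.1].

Definition above (c : curve) : set plane :=
  [set z | xl c <= z.1 <= xr c /\ height c z.1 < z.2].

Definition below (c : curve) : set plane :=
  [set z | xl c <= z.1 <= xr c /\ z.2 < height c z.1].

Definition left_of (e : plane) : set plane := [set z | z.1 < e.1].
Definition right_of (e : plane) : set plane := [set z | e.1 < z.1].

Definition interior_disjoint (n : nat) (S : 'I_n -> curve) : Prop :=
  forall i j, i != j -> curve_interior (S i) `&` curve_interior (S j) = set0.

Definition general_position (n : nat) (S : 'I_n -> curve) : Prop :=
  (forall i j e e', is_endpoint (S i) e -> is_endpoint (S j) e' ->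
     e.1 = e'.1 -> e = e') /\
  (forall i j e, i != j -> is_endpoint (S i) e -> ~ curve_interior (S j) e).

Section TrapezoidalMap.
Variable S : set curve.

Definition curves_union : set plane := \bigcup_(c in S) graph c.

(* The walls stop just before the first curve point met above or below [e];
   if there is none, they are unbounded. *)
Definition wall_up (e : plane) : set plane :=
  [set z | [/\ z.1 = e.1, e.2 < z.2 &
     forall y, e.2 < y <= z.2 -> ~ curves_union (e.1, y)]].

Definition wall_down (e : plane) : set plane :=
  [set z | [/\ z.1 = e.1, z.2 < e.2 &
     forall y, z.2 <= y < e.2 -> ~ curves_union (e.1, y)]].

Definition walls : set plane :=
  \bigcup_(e in [set e | exists2 c, S c & is_endpoint c e])
    (wall_up e `|` wall_down e).

Definition free_space : set plane := ~` (curves_union `|` walls).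

Definition trapezoidal_map : set (set plane) :=
  [set D | exists2 z, free_space z & D = connected_component free_space z].

Definition trapezoid_containing (P : set plane) : set plane :=
  xget set0 [set D | trapezoidal_map D /\ P `<=` D].

End TrapezoidalMap.

(* A DAG is represented by its unfolding, in which each inner node records the
   trapezoid of the leaf it replaced and the point or curve it tests.  These
   data determine the inner node (a leaf is replaced at most once, by at most
   one node for each of p_i, q_i, cv_i), and a leaf is determined by its
   trapezoid; hence equal subterms are exactly the occurrences of one shared
   node, and distinct subterms are distinct nodes of the DAG. *)
Inductive dag :=
| Leaf of set plane
| PointNode (D : set plane) (e : plane) (left right : dag)
| CurveNode (D : set plane) (c : curve) (up down : dag).

HB.instance Definition _ := gen_eqMixin dag.

(* The nodes replacing the leaf [D] when [c] is inserted; [S] contains [c].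
   Naming the leaf of each new piece after the trapezoid of the new map that
   contains it merges the pieces lying in a common trapezoid. *)
Definition split_leaf (S : set curve) (c : curve) (D : set plane) : dag :=
  let p := lpoint c in
  let q := rpoint c in
  let leaf P := Leaf (trapezoid_containing S P) in
  let D1 := if p \in D then D `&` right_of p else D in
  let D2 := if q \in D then D1 `&` left_of q else D1 in
  let curve_node :=
    CurveNode D c (leaf (D2 `&` above c)) (leaf (D2 `&` below c)) in
  let q_node :=
    if q \in D then PointNode D q curve_node (leaf (D1 `&` right_of q))
    else curve_node in
  if p \in D then PointNode D p (leaf (D `&` left_of p)) q_node else q_node.

Fixpoint insert_curve (S : set curve) (c : curve) (G : dag) : dag :=
  match G with
  | Leaf D => if D `&` graph c == set0 then Leaf D else split_leaf S c D
  | PointNode D e l r =>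
      PointNode D e (insert_curve S c l) (insert_curve S c r)
  | CurveNode D c' u d =>
      CurveNode D c' (insert_curve S c u) (insert_curve S c d)
  end.

(* The list starts with the curve inserted last. *)
Fixpoint history_rev (s : seq curve) : dag :=
  match s with
  | [::] => Leaf setT
  | c :: s' => insert_curve [set` c :: s'] c (history_rev s')
  end.

Definition history (n : nat) (S : 'I_n -> curve) (s : {perm 'I_n}) : dag :=
  history_rev (rev [seq S (s i) | i <- enum 'I_n]).

Fixpoint subdags (G : dag) : seq dag :=
  G :: match G with
       | Leaf _ => [::]
       | PointNode _ _ l r => subdags l ++ subdags r
       | CurveNode _ _ u d => subdags u ++ subdags d
       end.

Definition dag_size (G : dag) : nat := size (undup (subdags G)).

(* Number of node visits of the recursive verification algorithm started at [G]
   with the interval [lo, hi] of possible x-values. *)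
Fixpoint visits (G : dag) (lo hi : \bar R) : nat :=
  match G with
  | Leaf _ => 1
  | PointNode _ e l r =>
      if (lo <= e.1%:E <= hi)%E then (visits l lo e.1%:E + visits r e.1%:E hi).+1
      else if (hi < e.1%:E)%E then (visits l lo hi).+1
      else (visits r lo hi).+1
  | CurveNode _ _ u d => (visits u lo hi + visits d lo hi).+1
  end.

(* Every visit is charged one unit of time. *)
Definition verification_time (G : dag) : nat := visits G -oo%E +oo%E.

(* Probability and (conditional) expectation for a uniformly random insertion
   order. *)
Definition order_prob (n : nat) (A : pred {perm 'I_n}) : R :=
  #|A|%:R / #|{perm 'I_n}|%:R.

Definition order_mean (n : nat) (f : {perm 'I_n} -> R) : R :=
  (\sum_s f s) / #|{perm 'I_n}|%:R.

Definition order_cond_mean (n : nat) (A : pred {perm 'I_n})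
    (f : {perm 'I_n} -> R) : R :=
  (\sum_(s | A s) f s) / #|A|%:R.

End Curves.

(* Main.v *)
(* Unfolded along the x-intervals, the DAG has as visited leaves disjoint slabs:
   pieces of trapezoids, cut along walls that may have been retracted since.
   Inserting a curve [a] costs O(1) per visited leaf whose trapezoid meets [a].
   All but two of these leaves are charged to the endpoint [e] whose original
   wall bounds the slab: either [a] crosses that wall, or an endpoint of [a]
   falls into a trapezoid that the wall traversed.

   The original wall of [e] reached [u] exactly when the curve of [e] is older
   than all curves between [e] and [u] on the vertical line through [e]; let
   X(k) be the expected number of such pairs (e, u) for k curves.  In a random
   ordering the last curve can be taken to be a uniformly random one, the
   others keeping their order (backward analysis).  This gives
   k (X(k) - X(k-1)) <= X(k) + 4 k, hence X(k) <= 4 k H(k-1), and bounds the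
   expected number of charges at step k by O(1 + X(k) / k) = O(log k).

   A component of the free space is the slab between one curve (or none) above
   and one below, because the first curve met above or below a point is locally
   constant on the free space.  [trapezoid_containing] returns [set0] on a piece
   that no trapezoid contains; such a leaf is never split again, so there is no
   need to rule it out. *)
Require Import Defs.
From mathcomp Require Import all_boot all_order all_algebra perm ring lra zify.
From mathcomp Require Import all_classical all_reals all_analysis.
Import Order.TTheory GRing.Theory Num.Theory.
Import numFieldNormedType.Exports.
Set Implicit Arguments.
Unset Strict Implicit.
Unset Printing Implicit Defensive.
Local Open Scope classical_set_scope.
Local Open Scope ring_scope.

(** * Directions, general position for lists, and curves that do not cross *)

Section Geometry.
Variable R : realType.
Implicit Types (c u a : curve R) (s : seq (curve R)) (z : R * R).
Implicit Types (D : set (R * R)) (e : curve R * bool).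

(** One Boolean selects the direction, so each argument is written once for above and below; on
    abscissae it serves for right and left. *)
Definition dir_lt (up : bool) (x y : R) : bool := if up then x < y else y < x.

Definition spans c (x : R) : bool := xl c <= x <= xr c.
Definition inside c (x : R) : bool := xl c < x < xr c.

(** Curves may share endpoints, and the age of a wall is that of its curve; so an endpoint is kept
    together with a curve owning it. *)
Definition endpoint (e : curve R * bool) : R * R :=
  if e.2 then rpoint e.1 else lpoint e.1.

(** The second clause merges interior disjointness with the ban on endpoints inside other curves:
    [x] may be an end of [c] but not of [c']. *)
Definition generic s : Prop :=
  (forall e e', e.1 \in s -> e'.1 \in s ->
     (endpoint e).1 = (endpoint e').1 -> endpoint e = endpoint e') /\
  (forall c c' x, c \in s -> c' \in s -> c != c' ->
     spans c x -> inside c' x -> height c x != height c' x).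

Lemma generic_sub s s' : {subset s' <= s} -> generic s -> generic s'.
Proof.
move=> sub [g1 g2]; split.
  by move=> e e' /sub es /sub es'; exact: g1.
by move=> c c' x /sub cs /sub cs'; exact: g2.
Qed.

Lemma inside_spans c x : inside c x -> spans c x.
Proof. by case/andP=> h1 h2; rewrite /spans !ltW. Qed.

Lemma spans_conv c x1 x2 x : spans c x1 -> spans c x2 ->
  Num.min x1 x2 <= x <= Num.max x1 x2 -> spans c x.
Proof. by rewrite /spans /Num.min /Num.max; case: ltP => *; lra. Qed.

Lemma inside_conv c x1 x2 x : inside c x1 -> inside c x2 ->
  Num.min x1 x2 <= x <= Num.max x1 x2 -> inside c x.
Proof. by rewrite /inside /Num.min /Num.max; case: (ltP x1 x2) => *; lra. Qed.

Lemma height_near c x y up : spans c x -> dir_lt up y (height c x) ->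
  \forall x' \near x, spans c x' -> dir_lt up y (height c x').
Proof.
move=> sx hy.
have /subspace_continuousP /(_ x) cx := @height_continuous R c.
have {}cx : height c @ within `[xl c, xr c] (nbhs x) --> height c x.
  by apply: cx; rewrite /= in_itv; exact: sx.
have : \forall x' \near within `[xl c, xr c] (nbhs x), dir_lt up y (height c x').
  case: up hy => /= hy; first by apply: (cvgr_gt (height c x)) => //.
  by apply: (cvgr_lt (height c x)).
rewrite near_withinE; apply: filterS => x' h sx'.
by apply: h; rewrite /= in_itv; exact: sx'.
Qed.

(** The difference of the two heights is continuous between [x1] and [x2]; a change of sign would
    yield a zero, which genericity excludes. *)
Lemma nocross s c u x1 x2 up : generic s -> c \in s -> u \in s -> c != u ->
  spans c x1 -> spans c x2 -> inside u x1 -> inside u x2 ->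
  dir_lt up (height c x1) (height u x1) -> dir_lt up (height c x2) (height u x2).
Proof.
move=> [_ g2] cs us cu sc1 sc2 iu1 iu2 h1.
have sub v : spans v x1 -> spans v x2 ->
    {within `[Num.min x1 x2, Num.max x1 x2], continuous (height v)}.
  move=> h h'; apply: continuous_subspaceW (@height_continuous R v).
  move=> x; rewrite /= !in_itv /=; exact: spans_conv.
have := within_continuousB (sub u (inside_spans iu1) (inside_spans iu2)) (sub c sc1 sc2).
move=> /IVT ivt.
apply/negP => /negP h2.
have [||x] := ivt 0.
- by rewrite /Num.min /Num.max; case: (ltP x1 x2) => // /ltW.
- by move: up h1 h2 => [] /=; rewrite /Num.min /Num.max !fctE;
    case: (ltP x1 x2) => *; case: (ltP (_ - _)) => *; lra.
rewrite in_itv /= !fctE => hx hxx.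
have /eqP[] := g2 c u x cs us cu (spans_conv sc1 sc2 hx) (inside_conv iu1 iu2 hx).
by apply/eqP; rewrite -subr_eq0 -oppr_eq0 opprB hxx.
Qed.

(** * The first curve above or below a point *)

Definition beyond (up : bool) c z : bool :=
  spans c z.1 && dir_lt up z.2 (height c z.1).

Definition visible s (up : bool) c z : Prop :=
  [/\ c \in s, beyond up c z &
     forall c', c' \in s -> beyond up c' z ->
       ~~ dir_lt up (height c' z.1) (height c z.1)].

Lemma exists_nearest (T : eqType) (r : seq T) (P : pred T) (f : T -> R) (up : bool) :
  has P r ->
  exists x, [/\ x \in r, P x & forall y, y \in r -> P y -> ~~ dir_lt up (f y) (f x)].
Proof.
elim: r => //= t r IH; case: (boolP (has P r)) => [/IH [x [xr Px xm]] _|/hasPn hN].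
  case: (boolP (P t && dir_lt up (f t) (f x))) => [/andP[Pt tx]|ht].
    exists t; split; rewrite ?mem_head // => y; rewrite inE => /orP[/eqP->|yr] Py.
      by case: (up) => /=; rewrite ltxx.
    by have := xm y yr Py; case: (up) tx => /=; lra.
  exists x; split; rewrite ?inE ?xr ?orbT // => y; rewrite inE => /orP[/eqP->|yr] Py.
    by move: ht; rewrite Py.
  exact: xm.
rewrite orbF => Pt; exists t; split; rewrite ?mem_head // => y.
rewrite inE => /orP[/eqP->|/hN /negP //] _.
by case: (up) => /=; rewrite ltxx.
Qed.

Lemma visible_exists s up z : has (fun c => beyond up c z) s ->
  exists c, visible s up c z.
Proof.
move=> /(exists_nearest (fun c => height c z.1) up) [c [cs bc cm]].
by exists c.
Qed.

Lemma near_fst z (P : R -> Prop) :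
  (\forall x \near z.1, P x) -> \forall z' \near z, P z'.1.
Proof. by case: z => x y h; apply: (@cvg_fst _ _ (nbhs x) (nbhs y)). Qed.

Lemma near_snd z (P : R -> Prop) :
  (\forall x \near z.2, P x) -> \forall z' \near z, P z'.2.
Proof. by case: z => x y h; apply: (@cvg_snd _ _ (nbhs x) (nbhs y)). Qed.

Lemma beyond_near up c z : beyond up c z ->
  \forall z' \near z, spans c z'.1 -> beyond up c z'.
Proof.
move=> /andP[sc hc]; pose m := (z.2 + height c z.1) / 2.
have h1 : dir_lt up m (height c z.1) by rewrite /m; case: up hc => /= *; lra.
have h2 : dir_lt up z.2 m by rewrite /m; case: up hc {h1} => /= *; lra.
have n1 := near_fst (height_near sc h1).
have n2 : \forall z' \near z, dir_lt up z'.2 m.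
  apply: (near_snd (P := fun y => dir_lt up y m)).
  by case: up h2 {hc h1 n1} => /= h2; [apply: (lt_nbhsl h2)|apply: (lt_nbhsr h2)].
apply: filterS2 n1 n2 => z' k1 k2 sz'.
rewrite /beyond sz' /=; move: (k1 sz') k2.
by case: (up) => /= *; lra.
Qed.

Lemma not_spans_near c z : ~~ spans c z.1 -> \forall z' \near z, ~~ spans c z'.1.
Proof.
rewrite /spans negb_and -!ltNge => /orP[] h;
  apply: (near_fst (P := fun x => ~~ (xl c <= x <= xr c))).
  by have := lt_nbhsl h; apply: filterS => x hx; rewrite leNgt hx.
by have := lt_nbhsr h; apply: filterS => x hx; rewrite [X in _ && X]leNgt hx andbF.
Qed.

Lemma inside_near c z : inside c z.1 -> \forall z' \near z, inside c z'.1.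
Proof.
move=> /andP[h1 h2]; apply: (near_fst (P := fun x => inside c x)).
have n1 := lt_nbhsr h1; have n2 := lt_nbhsl h2.
by apply: filterS2 n1 n2 => x k1 k2; apply/andP.
Qed.

Lemma near_seq (T : eqType) (r : seq T) z (P : T -> R * R -> Prop) :
  (forall y, y \in r -> \forall z' \near z, P y z') ->
  \forall z' \near z, forall y, y \in r -> P y z'.
Proof.
elim: r => [|t r IH] h; first by apply: (@nearW _ (nbhs z)) => ? ?.
have n1 := h t (mem_head _ _).
have n2 : \forall z' \near z, forall y, y \in r -> P y z'.
  by apply: IH => y yr; apply: h; rewrite inE yr orbT.
apply: filterS2 n1 n2 => z' k1 k2 y; rewrite inE => /orP[/eqP->//|]; exact: k2.
Qed.

Lemma free_curve s z c : free_space [set` s] z -> c \in s -> spans c z.1 ->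
  height c z.1 != z.2.
Proof.
move=> fz cs sc; apply/eqP => e; apply: fz; left.
by exists c => //; split.
Qed.

(** At a free point, a curve that is not beyond either misses the abscissa or lies strictly on the
    other side, and both persist nearby. *)
Lemma not_beyond_near s up c z : free_space [set` s] z -> c \in s ->
  ~~ beyond up c z -> \forall z' \near z, ~~ beyond up c z'.
Proof.
move=> fz cs nb; case: (boolP (spans c z.1)) => sc; last first.
  by have := not_spans_near sc; apply: filterS => z' h; rewrite /beyond negb_and h.
have b : beyond (~~ up) c z.
  have := free_curve fz cs sc; move: nb; rewrite /beyond sc /=.
  by case: up => /=; rewrite neq_lt => + /orP[] *; lra.
have := beyond_near b; apply: filterS => z' h.
rewrite {1}/beyond; apply/negP => /andP[sz' h1].
by have := h sz'; rewrite /beyond sz' /=; case: up h1 {h nb b} => /= *; lra.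
Qed.

(** If the visible curve ended at the abscissa of [z], nothing would block the wall from that
    endpoint towards [z], so [z] would lie on a wall. *)
Lemma visible_inside s up c z : free_space [set` s] z -> visible s up c z ->
  inside c z.1.
Proof.
move=> fz [cs /andP[sc hc] cm].
suff H : forall b, (endpoint (c, b)).1 != z.1.
  move: (H true) (H false) sc; rewrite /inside /spans /= => h1 h2 /andP[h3 h4].
  by rewrite !lt_neqAle h2 h3 h4 (eq_sym z.1) h1.
move=> b; apply/eqP => eb; apply: (fz); right.
have e2 : (endpoint (c, b)).2 = height c z.1.
  by move: eb; rewrite /endpoint; case: b => /= ->.
exists (endpoint (c, b)); first by exists c => //; case: (b); [right|left].
have hno c' y : c' \in s -> graph c' (z.1, y) -> z.2 <= y -> y < height c z.1 ->
    up -> False.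
  move=> c's [/= sc' ey] l1 l2 Eup; rewrite Eup in cm hc.
  have {}sc' : spans c' z.1 := sc'.
  have zy : z.2 != y by rewrite eq_sym ey; apply: (free_curve fz c's).
  have := cm c' c's; rewrite /beyond sc' -ey /= lt_neqAle zy l1 => /(_ isT).
  by rewrite l2.
have hno' c' y : c' \in s -> graph c' (z.1, y) -> y <= z.2 -> height c z.1 < y ->
    ~~ up -> False.
  move=> c's [/= sc' ey] l1 l2 /negbTE Eup; rewrite Eup in cm hc.
  have {}sc' : spans c' z.1 := sc'.
  have zy : y != z.2 by rewrite ey; apply: (free_curve fz c's).
  have := cm c' c's; rewrite /beyond sc' -ey /= lt_neqAle zy l1 => /(_ isT).
  by rewrite l2.
case: up hc cm hno hno' => /= hc cm hno hno'; [right|left]; split; rewrite ?eb ?e2 //.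
  by move=> y /andP[h1 h2] [c' c's g]; apply: (hno c' y).
by move=> y /andP[h1 h2] [c' c's g]; apply: (hno' c' y).
Qed.

(** Every other curve beyond [z] is strictly farther than [c] by genericity, and the gap persists
    nearby; curves not beyond [z] stay so. *)
Lemma visible_near s up c z : generic s -> free_space [set` s] z ->
  visible s up c z -> \forall z' \near z, visible s up c z'.
Proof.
move=> gs fz vc; have ic := visible_inside fz vc.
case: (vc) => cs bc cm.
have n1 := inside_near ic; have n2 := beyond_near bc.
suff n3 : \forall z' \near z, forall c', c' \in s -> beyond up c' z' -> inside c z'.1 ->
    ~~ dir_lt up (height c' z'.1) (height c z'.1).
  apply: filterS3 n1 n2 n3 => z' k1 k2 k3; split => //.
    exact: k2 (inside_spans k1).
  by move=> c' c's b'; apply: k3.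
apply: (near_seq (P := fun c' z' => beyond up c' z' -> inside c z'.1 ->
    ~~ dir_lt up (height c' z'.1) (height c z'.1))) => c' c's.
case: (boolP (beyond up c' z)) => b'; last first.
  by have := not_beyond_near fz c's b'; apply: filterS => z' /negP.
case: (eqVneq c' c) => [->|cc].
  by apply: (@nearW _ (nbhs z)) => z' _ _; case: (up) => /=; rewrite ltxx.
have [sc' _] := andP b'.
have ne := gs.2 c' c z.1 c's cs cc sc' ic.
pose m := (height c' z.1 + height c z.1) / 2.
have lt : dir_lt up (height c z.1) (height c' z.1).
  move: (cm c' c's b') ne; case: (up) => /=; rewrite neq_lt => + /orP[] *; lra.
have k1 : dir_lt up m (height c' z.1) by rewrite /m; case: (up) lt => /= *; lra.
have k2 : dir_lt (~~ up) m (height c z.1) by rewrite /m; case: (up) lt => /= *; lra.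
have n3 := near_fst (height_near sc' k1).
have n4 := near_fst (height_near (inside_spans ic) k2).
apply: filterS2 n3 n4 => z' h3 h4 /andP[s' _] i'.
move: (h3 s') (h4 (inside_spans i')).
by case: (up) => /= *; lra.
Qed.

(** The two local hypotheses make the part of [A] where [P] holds relatively open and relatively
    closed. *)
Lemma connected_const (T : topologicalType) (A : set T) (P : T -> Prop) x :
  connected A -> A x -> P x ->
  (forall y, A y -> P y -> \forall z \near y, A z -> P z) ->
  (forall y, A y -> ~ P y -> \forall z \near y, A z -> ~ P z) ->
  forall y, A y -> P y.
Proof.
move=> cA Ax Px h1 h2 y Ay.
suff E : A `&` P = A by have [] : (A `&` P) y by rewrite E.
apply: cA; first by exists x.
- exists (interior [set z | A z -> P z]); first exact: open_interior.
  apply/seteqP; split => z [Az Pz]; split => //; first exact: h1.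
  exact: (interior_subset Pz).
- exists (~` interior [set z | A z -> ~ P z]).
    by apply: open_closedC; exact: open_interior.
  apply/seteqP; split => z [Az Pz]; split => //.
    by move=> /interior_subset /(_ Az).
  apply: contrapT => nP; apply: Pz; exact: h2.
Qed.

Lemma visible_constant s up c A z z' : generic s ->
  connected A -> A `<=` free_space [set` s] -> A z -> A z' ->
  visible s up c z -> visible s up c z'.
Proof.
move=> gs cA sA Az Az' vz.
apply: (connected_const (P := visible s up c) cA Az vz) => // y Ay.
  move=> /(visible_near gs (sA _ Ay)); exact: filterS.
(* Where [c] is not visible, either another curve [v] is visible and stays so nearby, and genericity
   excludes a tie with [c], or no curve is beyond any nearby point. *)
move=> nv; case: (boolP (has (fun c => beyond up c y) s)) => [/visible_exists [v vv]|/hasPn hN].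
  have n1 := visible_near gs (sA _ Ay) vv.
  apply: filterS n1 => w vw Aw vc.
  have cv : c != v by apply/eqP => e; rewrite e in nv.
  have iw := visible_inside (sA _ Aw) vw.
  case: vc vw => cs bc cm [vs bv vm].
  have [sc _] := andP bc.
  have := gs.2 c v w.1 cs vs cv sc iw.
  move: (cm v vs bv) (vm c cs bc); case: (up) => /=; rewrite neq_lt => + + /orP[]; lra.
have : \forall w \near y, forall c, c \in s -> ~~ beyond up c w.
  by apply: near_seq => c' c's; apply: not_beyond_near (sA _ Ay) c's (hN c' c's).
by apply: filterS => w hw Aw [cs bc _]; have := hw c cs; rewrite bc.
Qed.

(** * Trapezoids as vertical slabs *)

Definition bounded_by (up : bool) (o : option (curve R)) z : bool :=
  if o is Some c then inside c z.1 && dir_lt up z.2 (height c z.1) else true.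

(** This interface collects what later arguments use of a free-space component. The bound [None]
    stands for an unbounded side. *)
Record trapezoid s D (bd : bool -> option (curve R)) : Prop := Trapezoid {
  trap_bound : forall z up, D z -> bounded_by up (bd up) z;
  trap_full : forall x y y', D (x, y) ->
    (forall up, bounded_by up (bd up) (x, y')) -> D (x, y');
  trap_convex : forall z z' x, D z -> D z' -> z.1 <= x <= z'.1 ->
    exists y, D (x, y);
  trap_avoid : forall c x, c \in s -> spans c x -> ~ D (x, height c x);
  trap_mem : forall up c, bd up = Some c -> c \in s }.

(** A wall through [(x, y')] would either continue to [(x, y)], which is free, or start on the
    segment between them, putting a curve point there. *)
Lemma free_segment s x y y' : free_space [set` s] (x, y) ->
  (forall c, c \in s -> spans c x ->
     ~~ (Num.min y y' <= height c x <= Num.max y y')) ->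
  free_space [set` s] (x, y').
Proof.
move=> fz hs.
have nc c y'' : c \in s -> graph c (x, y'') ->
    Num.min y y' <= y'' <= Num.max y y' -> False.
  by move=> cs [/= sc ->]; apply/negP; exact: hs.
move=> [[c cs g]|[e [c cs ec]]].
  apply: (nc c y') => //; rewrite /Num.min /Num.max.
  by case: (ltP y y') => h; rewrite ?lexx ?h ?(ltW h).
have ge : graph c e.
  have := xl_lt_xr c; case: ec => ->; rewrite /graph /= lexx => /ltW -> //.
move=> [] [/= ex ey hw]; apply: fz; right; exists e; try by exists c.
- left; split => //=.
    rewrite ltNge; apply/negP => h; apply: (nc c e.2 cs).
      by case: (e) ge ex => e1 e2 /= + ->.
    by rewrite /Num.min /Num.max; case: (ltP y y') => *; lra.
  move=> t ht gt; case: (lerP t y') => ty; first by apply: (hw t) => //; lra.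
  case: gt => c' c's g'; apply: (nc c' t c's); first by rewrite ex.
  by rewrite /Num.min /Num.max; case: (ltP y y') => *; lra.
- right; split => //=.
    rewrite ltNge; apply/negP => h; apply: (nc c e.2 cs).
      by case: (e) ge ex => e1 e2 /= + ->.
    by rewrite /Num.min /Num.max; case: (ltP y y') => *; lra.
  move=> t ht gt; case: (lerP y' t) => ty; first by apply: (hw t) => //; lra.
  case: gt => c' c's g'; apply: (nc c' t c's); first by rewrite ex.
  by rewrite /Num.min /Num.max; case: (ltP y y') => *; lra.
Qed.

Lemma component_convex (A : set (R * R)) z z' x : connected A -> A z -> A z' ->
  z.1 <= x <= z'.1 -> exists y, A (x, y).
Proof.
move=> cA Az Az' hx.
have : connected (fst @` A).
  apply: connected_continuous_connected => //.
  by apply: continuous_subspaceT => w; exact: cvg_fst.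
move=> /connected_intervalP iA.
have [||[x' y] Aw /= <-] := iA z.1 z'.1 _ _ x hx.
- by exists z.
- by exists z'.
by exists y.
Qed.

Lemma continuous_pairr (x : R) : continuous (fun t : R => (x, t)).
Proof.
move=> t.
have h1 : (fun _ : R => x) @ t --> x by exact: cvg_cst.
have h2 : (fun t : R => t) @ t --> t by exact: cvg_id.
exact: (cvg_pair h1 h2).
Qed.

Lemma connected_vsegment (x y y' : R) :
  connected [set (x, t) | t in [set` `[Num.min y y', Num.max y y']]].
Proof.
apply: connected_continuous_connected; first exact/connected_intervalP/interval_is_interval.
apply: continuous_subspaceT; exact: continuous_pairr.
Qed.

Lemma component_trapezoid s z : generic s -> free_space [set` s] z ->
  exists bd, trapezoid s (connected_component (free_space [set` s]) z) bd.
Proof.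
move=> gs fz; set F := free_space _; set D := connected_component F z.
have cD : connected D by exact: component_connected.
have sD : D `<=` F by exact: connected_component_sub.
have Dz : D z by exact: connected_component_refl.
(* The bound is the curve visible from [z]; if there is none, constancy of visibility shows that no
   curve is beyond any point of the component. *)
have /all_sig [bd hbd] : forall up, {o | if o is Some c then visible s up c z
    else forall w, D w -> forall c, c \in s -> ~~ beyond up c w}.
  move=> up; apply: cid.
  case: (pselect (exists c, visible s up c z)) => [[c vc]|nv]; first by exists (Some c).
  exists None => w Dw c cs; apply/negP => bc; apply: nv.
  have [|v vv] := @visible_exists s up w; first by apply/hasP; exists c.
  by exists v; apply: (visible_constant gs cD sD Dw Dz).
have vis up c w : bd up = Some c -> D w -> visible s up c w.
  by move=> e Dw; have := hbd up; rewrite e => vz; apply: (visible_constant gs cD sD Dz Dw).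
exists bd; split.
- move=> w up Dw; have := vis up _ w; case e : (bd up) => [c|] //= /(_ c erefl Dw) vc.
  rewrite (visible_inside (sD _ Dw) vc) /=.
  by case: vc => _ /andP[].
- move=> x y y' Dy by'.
  (* A curve meeting the segment would lie at or past the visible one in its direction, which is
     past [y']. So the segment is free, and being connected it stays in the component. *)
  have seg t : Num.min y y' <= t <= Num.max y y' -> F (x, t).
    move=> ht; apply: (free_segment (sD _ Dy)) => c cs sc; apply/negP => hc.
    have ne := free_curve (sD _ Dy) cs sc; rewrite /= in ne.
    have b : beyond (y < height c x) c (x, y).
      rewrite /beyond sc /=; move: ne; rewrite neq_lt.
      by case: (ltP y (height c x)) => //= _; rewrite orbF.
    have := by' (y < height c x); have := hbd (y < height c x).
    case e : (bd (y < height c x)) => [v|] /=; last by move=> /(_ _ Dy _ cs) /negP.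
    move=> _ /andP[_ hv].
    have [_ _ /(_ c cs b) /=] := vis _ _ _ e Dy.
    move: ht hc hv ne; clear e; rewrite neq_lt /Num.min /Num.max.
    by case: (ltP y (height c x)) => /=; case: (ltP y y'); case: (ltP y t) => *; lra.
  have -> : D = connected_component F (x, y) by exact: same_connected_component.
  apply: (connected_component_max
    (B := [set (x, t) | t in [set` `[Num.min y y', Num.max y y']]])).
  + by exists y => //; rewrite /= in_itv /= ge_min le_max lexx.
  + by move=> _ [t + <-]; rewrite /= in_itv; exact: seg.
  + exact: connected_vsegment.
  + by exists y' => //; rewrite /= in_itv /= ge_min le_max lexx !orbT.
- by move=> w w' x; exact: component_convex.
- by move=> c x cs sc /sD f; have := free_curve f cs sc; rewrite eqxx.
- by move=> up c /vis /(_ Dz) [].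
Qed.

Lemma trapezoid_containingP s (P : set (R * R)) : generic s ->
  let D := trapezoid_containing [set` s] P in
  D = set0 \/ P `<=` D /\ exists bd, trapezoid s D bd.
Proof.
move=> gs /=; rewrite /trapezoid_containing;
  case: xgetP => [D -> [[z fz ->] sP]|]; last by left.
by right; split => //; apply: component_trapezoid.
Qed.

(** If no bound of [D] came at or before [c], the point of [c] on the vertical line of [z] would
    belong to [D], which avoids the curves of [s]. *)
Lemma trap_gap s D bd c z up : trapezoid s D bd -> c \in s -> D z ->
  beyond up c z ->
  exists u, [/\ bd up = Some u, u \in s, inside u z.1, dir_lt up z.2 (height u z.1) &
    ~~ dir_lt up (height c z.1) (height u z.1)].
Proof.
move=> tD cs Dz /andP[sc hc].
case: (pselect (bounded_by up (bd up) (z.1, height c z.1))) => [bz|].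
  case: (trap_avoid tD cs sc); apply: (trap_full tD (y := z.2)); first by case: z Dz {hc sc bz}.
  move=> up'; case: (eqVneq up' up) => [->//|].
  have := trap_bound tD up' Dz; case: (bd up') => [u|] //= /andP[-> /=] + nu.
  by move: hc; case: (up) nu; case: up' => //= *; lra.
have := trap_bound tD up Dz; case e : (bd up) => [u|] //= /andP[iu hu] /negP.
rewrite iu /= => /negP nu; exists u; split => //; last exact/negP.
exact: (trap_mem tD e).
Qed.

(** The bound of [D] found at or before [c] is not crossed by [c], so it keeps [D] on one side of
    [c]. *)
Lemma trap_same_side s D bd c z z' up : generic s -> trapezoid s D bd ->
  c \in s -> D z -> D z' -> spans c z'.1 -> beyond up c z -> beyond up c z'.
Proof.
move=> gs tD cs Dz Dz' sc' bc; apply/negP => /negP.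
have sc := (andP bc).1.
have [u [eu us iu hu nu]] := trap_gap tD cs Dz bc.
have := trap_bound tD up Dz'; rewrite eu /= => /andP[iu' hu'].
rewrite /beyond sc' /= => nc.
have lt' : dir_lt up (height c z'.1) (height u z'.1).
  by clear eu; case: (up) nc hu' => /= *; lra.
case: (eqVneq c u) => [ecu|cu].
  by move: lt'; rewrite ecu; case: (up); rewrite /= ltxx.
by have := nocross gs cs us cu sc' sc iu' iu lt'; rewrite (negbTE nu).
Qed.

(** A new curve that meets [D] cannot cross the bounds of [D], so it leaves [D] only where it ends
    or [D] ends. *)
Lemma trap_follow s D bd a x0 x y : generic (a :: s) -> a \notin s ->
  trapezoid s D bd -> D (x0, height a x0) -> D (x, y) ->
  spans a x0 -> spans a x -> D (x, height a x).
Proof.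
move=> gs as_ tD D0 Dx s0 sx; apply: (trap_full tD Dx) => up.
have := trap_bound tD up D0; have := trap_bound tD up Dx.
case e : (bd up) => [u|] //= /andP[iu _] /andP[iu0 h0]; rewrite iu /=.
have us := trap_mem tD e.
apply: (nocross (x1 := x0) gs _ _ _ s0 sx iu0 iu h0); rewrite ?mem_head //.
- by rewrite inE us orbT.
- by apply: contraNneq as_ => ->.
Qed.

Lemma trap_open s D bd x y up : trapezoid s D bd -> D (x, y) ->
  exists y', dir_lt up y y' /\ D (x, y').
Proof.
move=> tD Dy; have := trap_bound tD up Dy.
have fl y' : bounded_by up (bd up) (x, y') -> dir_lt up y y' -> D (x, y').
  move=> b lt; apply: (trap_full tD Dy) => up'.
  case: (eqVneq up' up) => [->//|].
  have := trap_bound tD up' Dy; case: (bd up') => [u|] //= /andP[-> /=] + nu.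
  by move: lt; case: (up) nu; case: up' => //= *; lra.
case e : (bd up) fl => [u|] fl /=.
  case/andP=> /= iu hu; exists ((y + height u x) / 2); clear e.
  have lt : dir_lt up y ((y + height u x) / 2) by case: (up) hu => /= *; lra.
  by split => //; apply: fl => //=; rewrite iu /=; case: (up) hu => /= *; lra.
move=> _; exists (if up then y + 1 else y - 1); clear e.
have lt : dir_lt up y (if up then y + 1 else y - 1) by case: (up) => /=; lra.
by split => //; apply: fl.
Qed.

Lemma trap_graph s D bd c z : trapezoid s D bd -> c \in s -> graph c z -> ~ D z.
Proof. by case: z => x y tD cs [/= sc ->]; exact: (trap_avoid tD cs sc). Qed.

Lemma graph_endpoint (e : curve R * bool) : graph e.1 (endpoint e).
Proof.
by case: e => c b; have := xl_lt_xr c; case: b; rewrite /graph /= lexx => /ltW ->.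
Qed.

Lemma trapezoid_cons s D bd a : trapezoid s D bd -> D `&` graph a = set0 ->
  trapezoid (a :: s) D bd.
Proof.
move=> [t1 t2 t3 t4 t5] Da; split => //.
  move=> c x; rewrite inE => /orP[/eqP-> sa Dx|]; last exact: t4.
  suff : (D `&` graph a) (x, height a x) by rewrite Da.
  by split => //; split.
by move=> up c /t5; rewrite inE => ->; rewrite orbT.
Qed.

Lemma trapezoid_setT : trapezoid ([::] : seq (curve R)) setT (fun=> None).
Proof. by split => // z z' x _ _ _; exists 0. Qed.

Local Notation leaf := (set (R * R) * (\bar R * \bar R))%type.

(** * Visited leaves *)

Definition region (l : leaf) : set (R * R) :=
  [set z | l.1 z /\ (l.2.1 < z.1%:E < l.2.2)%E].

(* A finite bound of the interval of a visited leaf is the abscissa of an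
   endpoint whose original wall reached the leaf: nothing at least as old as
   the endpoint's curve comes in between. *)
Definition wall_ok s (Q : set (R * R)) (w : R) : Prop :=
  exists e : curve R * bool, [/\ e.1 \in s, w = (endpoint e).1 &
    forall c z up, c \in s -> (index e.1 s <= index c s)%N -> Q z ->
      spans c z.1 -> beyond up c (endpoint e) -> beyond up c z].

(** The first alternative is the default leaf, which no curve hits. After merging, a trapezoid may
    extend past the visited interval, so only covering the interval is required. *)
Definition leaf_ok s (l : leaf) : Prop :=
  l.1 = set0 \/
  [/\ (l.2.1 < l.2.2)%E, exists bd, trapezoid s l.1 bd,
      forall x : R, (l.2.1 < x%:E < l.2.2)%E -> exists y, l.1 (x, y) &
      forall w : R, w%:E = l.2.1 \/ w%:E = l.2.2 -> wall_ok s (region l) w].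

Lemma wall_ok_sub s Q Q' w : Q' `<=` Q -> wall_ok s Q w -> wall_ok s Q' w.
Proof.
move=> sub [e [e1 e2 h]]; exists e; split => // c z up cs ic /sub; exact: h.
Qed.

(** The added curve has index 0, hence is younger than the curve of the wall and exempt from the
    condition. *)
Lemma wall_ok_cons s Q w a : a \notin s -> wall_ok s Q w -> wall_ok (a :: s) Q w.
Proof.
move=> as_ [e [e1 e2 h]]; exists e; split => //; first by rewrite inE e1 orbT.
have ae : a == e.1 = false by apply/negbTE; apply: contraNneq as_ => ->.
move=> c z up; rewrite inE /= ae => /orP[/eqP->|cs]; first by rewrite eqxx.
have -> : a == c = false by apply/negbTE; apply: contraNneq as_ => ->.
by rewrite ltnS; exact: h.
Qed.

(** For the youngest curve no other curve is exempt; the condition holds because [D] lies on one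
    side of every curve of [s], and [a] itself passes through its endpoint. *)
Lemma wall_ok_new s D bd a b : generic s -> trapezoid s D bd ->
  D (endpoint (a, b)) -> wall_ok (a :: s) D (endpoint (a, b)).1.
Proof.
move=> gs tD De; exists (a, b); split; rewrite ?mem_head // => c z up.
rewrite inE => /orP[/eqP-> _ _ _|cs _ Dz sc]; last exact: (trap_same_side gs tD cs De Dz sc).
by rewrite /beyond /endpoint; case: b {De}; case: up; rewrite /= ltxx andbF.
Qed.

Definition admissible s a D lo hi (w : R) : Prop :=
  wall_ok s (region (D, (lo, hi))) w \/
  exists b, D (endpoint (a, b)) /\ w = (endpoint (a, b)).1.

(** Equal abscissae would make the endpoints coincide, and [D] would contain a point of an old
    curve. So an inserted point node never falls exactly on an inherited bound of the interval. *)
Lemma wall_ok_neq s D bd Q a b w : generic (a :: s) -> trapezoid s D bd ->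
  D (endpoint (a, b)) -> wall_ok s Q w -> w != (endpoint (a, b)).1.
Proof.
move=> [g1 _] tD De [e [e1 -> _]]; apply/eqP => h.
have E : endpoint e = endpoint (a, b).
  by apply: g1 => //; rewrite ?mem_head // inE e1 orbT.
by apply: (trap_graph tD e1 (graph_endpoint e)); rewrite E.
Qed.

Fixpoint visited (G : dag R) (lo hi : \bar R) : seq leaf :=
  match G with
  | Leaf D => [:: (D, (lo, hi))]
  | PointNode _ e l r =>
      if (lo <= e.1%:E <= hi)%E then visited l lo e.1%:E ++ visited r e.1%:E hi
      else if (hi < e.1%:E)%E then visited l lo hi else visited r lo hi
  | CurveNode _ _ u d => visited u lo hi ++ visited d lo hi
  end.

Definition disjoint_leaves (l l' : leaf) : bool :=
  `[< forall z, region l z -> region l' z -> False >].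

(** * Splitting one visited leaf *)

Section Refinement.
Variables (s : seq (curve R)) (a : curve R) (D : set (R * R)) (lo hi : \bar R).
Variables (bd : bool -> option (curve R)) (x0 : R).
Hypothesis gs : generic (a :: s).
Hypothesis as_ : a \notin s.
Hypothesis lohi : (lo < hi)%E.
Hypothesis tD : trapezoid s D bd.
Hypothesis covD : forall x : R, (lo < x%:E < hi)%E -> exists y, D (x, y).
Hypothesis wallD : forall w : R, w%:E = lo \/ w%:E = hi -> wall_ok s (region (D, (lo, hi))) w.
Hypothesis sa0 : spans a x0.
Hypothesis Da0 : D (x0, height a x0).

Let tc P := trapezoid_containing [set` a :: s] P.
Let gs' : generic s.
Proof. by apply: generic_sub gs => c cs; rewrite inE cs orbT. Qed.

Let adm (w : \bar R) := forall r : R, w = r%:E -> admissible s a D lo hi r.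

Let admlo : adm lo.
Proof. by move=> r e; left; apply: wallD; left. Qed.

Let admhi : adm hi.
Proof. by move=> r e; left; apply: wallD; right. Qed.

Let admend b : D (endpoint (a, b)) -> adm (endpoint (a, b)).1%:E.
Proof. by move=> De r [<-]; right; exists b. Qed.

(** Merging may name the new leaf after a trapezoid reaching outside [D]. Within the interval it
    still lies in [D] and on the side of [a] where [P] lies: every column contains a point of [P],
    and the named trapezoid is on one side of each curve. *)
Let piece P lo1 hi1 :
  (lo <= lo1)%E -> (lo1 < hi1)%E -> (hi1 <= hi)%E -> adm lo1 -> adm hi1 ->
  P `<=` D -> (forall x : R, (lo1 < x%:E < hi1)%E -> exists y, P (x, y)) ->
  leaf_ok (a :: s) (tc P, (lo1, hi1)) /\
  forall z, region (tc P, (lo1, hi1)) z ->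
    [/\ D z, (lo1 < z.1%:E < hi1)%E &
     forall up, (forall w, P w -> beyond up a w) -> beyond up a z].
Proof.
move=> lo1P lohi1 hi1P alo ahi PD covP.
have [E|[PD' [bd' tD']]] := trapezoid_containingP P gs.
  split; first by left; exact: E.
  by move=> z [/=]; rewrite /tc E.
have sub z : region (tc P, (lo1, hi1)) z -> [/\ D z, (lo1 < z.1%:E < hi1)%E &
     forall up, (forall w, P w -> beyond up a w) -> beyond up a z].
  move=> [/= D'z hz]; have [y Py] := covP _ hz; split => //.
    case: z D'z hz Py => x y' /= D'z hz Py.
    apply: (trap_full tD (PD _ Py)) => up.
    have := trap_bound tD up (PD _ Py); case e : (bd up) => [u|] //= /andP[iu hu].
    have bu : beyond up u (x, y) by rewrite /beyond (inside_spans iu).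
    have us : u \in a :: s by rewrite inE (trap_mem tD e) orbT.
    have := trap_same_side gs tD' us (PD' _ Py) D'z (inside_spans iu) bu.
    by rewrite iu => /andP[_].
  move=> up /(_ _ Py) ba.
  exact: (trap_same_side gs tD' (mem_head _ _) (PD' _ Py) D'z (andP ba).1 ba).
split => //; right; split => //=; first by exists bd'.
  by move=> x /covP [y Py]; exists y; exact: PD'.
have sub' z : region (tc P, (lo1, hi1)) z -> region (D, (lo, hi)) z.
  move=> /sub [Dz /andP[h1 h2] _]; split => //=.
  by rewrite (le_lt_trans lo1P h1) (lt_le_trans h2 hi1P).
move=> w hw.
have : admissible s a D lo hi w by case: hw => [/esym/alo|/esym/ahi].
case=> [h|[b [Db ->]]].
  by apply: wall_ok_cons => //; apply: wall_ok_sub h.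
apply: wall_ok_sub (wall_ok_new gs' tD Db) => z /sub [] //.
Qed.

Let fine (lo1 hi1 : \bar R) (L : seq leaf) : Prop :=
  (forall l, l \in L -> leaf_ok (a :: s) l /\
     forall z, region l z -> D z /\ (lo1 < z.1%:E < hi1)%E) /\
  pairwise disjoint_leaves L.

Let fine_cat lo1 hi1 x L1 L2 : (lo1 <= x)%E -> (x <= hi1)%E ->
  fine lo1 x L1 -> fine x hi1 L2 -> fine lo1 hi1 (L1 ++ L2).
Proof.
move=> h1 h2 [f1 p1] [f2 p2]; split.
  move=> l; rewrite mem_cat => /orP[/f1|/f2] [lk hl]; split => // z /hl [Dz /andP[k1 k2]].
    by rewrite k1 (lt_le_trans k2 h2).
  by rewrite k2 (le_lt_trans h1 k1).
rewrite pairwise_cat p1 p2 !andbT; apply/allrelP => l l' /f1 [_ k1] /f2 [_ k2].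
apply/asboolP => z /k1 [_ /andP[_ h]] /k2 [_ /andP[h' _]].
by have := lt_trans h h'; rewrite ltxx.
Qed.

Let leaf_stage P lo1 hi1 :
  (lo <= lo1)%E -> (lo1 < hi1)%E -> (hi1 <= hi)%E -> adm lo1 -> adm hi1 ->
  P `<=` D -> (forall x y, (lo1 < x%:E < hi1)%E -> D (x, y) -> P (x, y)) ->
  fine lo1 hi1 [:: (tc P, (lo1, hi1))].
Proof.
move=> lo1P lohi1 hi1P alo ahi PD DP.
have [|ok sub] := piece lo1P lohi1 hi1P alo ahi PD.
  move=> x hx; have [|y Dy] := covD (x := x); last by exists y; exact: DP.
  by case/andP: hx => h1 h2; rewrite (le_lt_trans lo1P h1) (lt_le_trans h2 hi1P).
split => // l; rewrite inE => /eqP->; split => // z /sub [].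
by split.
Qed.

Let curve_stage P lo1 hi1 :
  (lo <= lo1)%E -> (lo1 < hi1)%E -> (hi1 <= hi)%E -> adm lo1 -> adm hi1 ->
  P `<=` D -> (forall x y, (lo1 < x%:E < hi1)%E -> D (x, y) -> P (x, y)) ->
  (forall x : R, (lo1 < x%:E < hi1)%E -> spans a x) ->
  fine lo1 hi1 [:: (tc (P `&` above a), (lo1, hi1)); (tc (P `&` below a), (lo1, hi1))].
Proof.
move=> lo1P lohi1 hi1P alo ahi PD DP sp.
have on x : (lo1 < x%:E < hi1)%E -> D (x, height a x).
  move=> hx; have [|y Dy] := covD (x := x).
    by case/andP: hx => h1 h2; rewrite (le_lt_trans lo1P h1) (lt_le_trans h2 hi1P).
  exact: (trap_follow gs as_ tD Da0 Dy sa0 (sp _ hx)).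
have sub Q : P `&` Q `<=` D by move=> z [/PD].
have [|ok1 sub1] := piece lo1P lohi1 hi1P alo ahi (sub (above a)).
  move=> x hx; have [y [h Dy]] := trap_open true tD (on _ hx).
  by exists y; split; [exact: DP|split => //; exact: sp].
have [|ok2 sub2] := piece lo1P lohi1 hi1P alo ahi (sub (below a)).
  move=> x hx; have [y [h Dy]] := trap_open false tD (on _ hx).
  by exists y; split; [exact: DP|split => //; exact: sp].
split.
  by move=> l; rewrite !inE => /orP[] /eqP->; split => // z; [move=> /sub1 []|move=> /sub2 []].
rewrite /= !andbT; apply/asboolP => z /sub1 [_ _ h1] /sub2 [_ _ h2].
have : beyond false a z by apply: h1 => w [_ [h k]]; rewrite /beyond /= k andbT.
have : beyond true a z by apply: h2 => w [_ [h k]]; rewrite /beyond /= k andbT.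
by rewrite /beyond /= => /andP[_ k1] /andP[_ k2]; have := lt_trans k1 k2; rewrite ltxx.
Qed.

(** The alternatives for [hi'] and [lo'] cover both outcomes of the test: the interval is cut at the
    point, or the point lies outside and the interval is kept. *)
Let point_stage lo1 hi1 D0 p l r : (lo1 < hi1)%E -> lo1 != p.1%:E -> hi1 != p.1%:E ->
  (forall hi', (lo1 < hi')%E -> (hi' <= hi1)%E -> (hi' <= p.1%:E)%E ->
     hi' = hi1 \/ hi' = p.1%:E -> fine lo1 hi' (visited l lo1 hi')) ->
  (forall lo', (lo1 <= lo')%E -> (lo' < hi1)%E -> (p.1%:E <= lo')%E ->
     lo' = lo1 \/ lo' = p.1%:E -> fine lo' hi1 (visited r lo' hi1)) ->
  fine lo1 hi1 (visited (PointNode D0 p l r) lo1 hi1).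
Proof.
move=> lohi1 ne1 ne2 hl hr /=; case: ifPn => [/andP[h1 h2]|].
  have h1' : (lo1 < p.1%:E)%E by rewrite lt_neqAle ne1.
  have h2' : (p.1%:E < hi1)%E by rewrite lt_neqAle eq_sym ne2.
  by apply: (fine_cat h1 h2); [apply: hl => //; right|apply: hr => //; right].
rewrite negb_and -!ltNge => h.
case: ifPn => h'; first by apply: hl => //; [exact: ltW|left].
move: h; rewrite (negbTE h') orbF => h.
by apply: hr => //; [exact: ltW|left].
Qed.

Let admN b (w : R) : D (endpoint (a, b)) -> w%:E = lo \/ w%:E = hi ->
  w != (endpoint (a, b)).1.
Proof. by move=> Db /wallD h; apply: (wall_ok_neq gs tD Db h). Qed.

Let loN b : D (endpoint (a, b)) -> lo != (endpoint (a, b)).1%:E.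
Proof.
move=> Db; apply/eqP => E; have := @admN b (endpoint (a, b)).1 Db.
by rewrite eqxx => /(_ (or_introl (esym E))).
Qed.

Let hiN b : D (endpoint (a, b)) -> hi != (endpoint (a, b)).1%:E.
Proof.
move=> Db; apply/eqP => E; have := @admN b (endpoint (a, b)).1 Db.
by rewrite eqxx => /(_ (or_intror (esym E))).
Qed.

(** If the interval reached left of [xl a], convexity would give [D] a point at that abscissa, and
    following [a] from [x0] would put its left endpoint in [D]. *)
Let left_spans x : ~ D (lpoint a) -> (lo < x%:E < hi)%E -> xl a <= x.
Proof.
move=> np hx; rewrite leNgt; apply/negP => h; apply: np.
have [y Dy] := covD hx; case/andP: (sa0) => h1 h2.
have [y' Dy'] := trap_convex tD Dy Da0 (x := xl a) ltac:(by rewrite /= (ltW h)).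
apply: (trap_follow gs as_ tD Da0 Dy' sa0).
by rewrite /spans lexx ltW // xl_lt_xr.
Qed.

Let right_spans x : ~ D (rpoint a) -> (lo < x%:E < hi)%E -> x <= xr a.
Proof.
move=> np hx; rewrite leNgt; apply/negP => h; apply: np.
have [y Dy] := covD hx; case/andP: (sa0) => h1 h2.
have [y' Dy'] := trap_convex tD Da0 Dy (x := xr a) ltac:(by rewrite /= h2 (ltW h)).
apply: (trap_follow gs as_ tD Da0 Dy' sa0).
by rewrite /spans lexx andbT ltW // xl_lt_xr.
Qed.

Lemma refine_fine : fine lo hi (visited (split_leaf [set` a :: s] a D) lo hi).
Proof.
rewrite /split_leaf -!/(tc _).
have ptqt : ((xl a)%:E < (xr a)%:E)%E by rewrite lte_fin xl_lt_xr.
have np : lpoint a \notin D -> ~ D (lpoint a) by move/negP => h k; apply: h; rewrite in_setE.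
have nq : rpoint a \notin D -> ~ D (rpoint a) by move/negP => h k; apply: h; rewrite in_setE.
have mid lo1 hi1 (x : R) : (lo <= lo1)%E -> (hi1 <= hi)%E ->
    (lo1 < x%:E < hi1)%E -> (lo < x%:E < hi)%E.
  by move=> h1 h2 /andP[h3 h4]; rewrite (le_lt_trans h1 h3) (lt_le_trans h4 h2).
have lf (p : R * R) (x y : R) (w : \bar R) :
    (x%:E < w)%E -> (w <= p.1%:E)%E -> left_of p (x, y).
  by rewrite /left_of /= -lte_fin; exact: lt_le_trans.
have rt (p : R * R) (x y : R) (w : \bar R) :
    (w < x%:E)%E -> (p.1%:E <= w)%E -> right_of p (x, y).
  by rewrite /right_of /= -lte_fin => h k; exact: le_lt_trans k h.
(* Where an endpoint of [a] is not in [D], [left_spans] or [right_spans] shows that [a] extends to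
   that end of the interval. *)
case: (boolP (lpoint a \in D)) => [|/np] pD; case: (boolP (rpoint a \in D)) => [|/nq] qD.
- rewrite !in_setE in pD qD.
  have ap := admend (b := false) pD; have aq := admend (b := true) qD.
  apply: point_stage => //; [exact: (loN (b := false))|exact: (hiN (b := false))| |].
    move=> hi' h1 h2 h3 hh; apply: leaf_stage => //; first by case: hh => ->.
    by move=> x y /andP[k1 k2] Dxy; split => //; exact: lf k2 h3.
  move=> lo' h1 h2 h3 hh.
  have alo' : adm lo' by case: hh => ->.
  have lo'N : lo' != (rpoint a).1%:E.
    by case: hh => -> /=; [exact: (loN (b := true))|rewrite lt_eqF].
  apply: point_stage => //; first exact: (hiN (b := true)).
    move=> hi' k1 k2 k3 kk.
    have ahi' : adm hi' by case: kk => ->.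
    apply: curve_stage => //.
    + by move=> z [[]].
    + move=> x y /andP[g1 g2] Dxy; split; first split => //.
        exact: rt g1 h3.
      exact: lf g2 k3.
    + move=> x /andP[g1 g2]; apply/andP; split; rewrite -lee_fin.
        exact: le_trans h3 (ltW g1).
      exact: le_trans (ltW g2) k3.
  move=> lo2 k1 k2 k3 kk.
  apply: leaf_stage => //; first exact: le_trans h1 k1.
  + by case: kk => ->.
  + by move=> z [[]].
  + move=> x y /andP[g1 g2] Dxy; split; first split => //.
      exact: rt g1 (le_trans h3 k1).
    exact: rt g1 k3.
- rewrite !in_setE in pD.
  have ap := admend (b := false) pD.
  apply: point_stage => //; [exact: (loN (b := false))|exact: (hiN (b := false))| |].
    move=> hi' h1 h2 h3 hh; apply: leaf_stage => //; first by case: hh => ->.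
    by move=> x y /andP[k1 k2] Dxy; split => //; exact: lf k2 h3.
  move=> lo' h1 h2 h3 hh.
  have alo' : adm lo' by case: hh => ->.
  apply: curve_stage => //.
  + by move=> x y /andP[g1 g2] Dxy; split => //; exact: rt g1 h3.
  + move=> x hx; apply/andP; split; last by apply: right_spans => //; apply: mid hx.
    by case/andP: hx => g1 g2; rewrite -lee_fin; exact: le_trans h3 (ltW g1).
- rewrite !in_setE in qD.
  have aq := admend (b := true) qD.
  apply: point_stage => //; [exact: (loN (b := true))|exact: (hiN (b := true))| |].
    move=> hi' k1 k2 k3 kk.
    have ahi' : adm hi' by case: kk => ->.
    apply: curve_stage => //.
    + by move=> x y /andP[g1 g2] Dxy; split => //; exact: lf g2 k3.
    + move=> x hx; apply/andP; split; first by apply: left_spans => //; apply: mid hx.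
      by case/andP: hx => g1 g2; rewrite -lee_fin; exact: le_trans (ltW g2) k3.
  move=> lo2 k1 k2 k3 kk.
  apply: leaf_stage => //; first by case: kk => ->.
  by move=> x y /andP[g1 g2] Dxy; split => //; exact: rt g1 k3.
- apply: curve_stage => //.
  by move=> x hx; apply/andP; split; [exact: left_spans|exact: right_spans].
Qed.

End Refinement.

(** * Effect of one insertion on the visited leaves *)

Definition hit a (l : leaf) : bool := l.1 `&` graph a != set0.

Definition refine s a (l : leaf) : seq leaf :=
  if hit a l then visited (split_leaf [set` a :: s] a l.1) l.2.1 l.2.2 else [:: l].

Lemma visited_insert s a G lo hi :
  visited (insert_curve [set` a :: s] a G) lo hi =
  flatten (map (refine s a) (visited G lo hi)).
Proof.
elim: G lo hi => [D|D e l IHl r IHr|D c u IHu d IHd] lo hi /=.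
- rewrite cats0 /refine /hit /=; by case: eqP.
- by rewrite !IHl !IHr; case: ifP => // _; [rewrite map_cat flatten_cat|case: ifP].
- by rewrite IHu IHd map_cat flatten_cat.
Qed.

(** At most two point nodes, one curve node and four leaves. They replace one visit, hence the
    factor 6 in the next lemma. *)
Lemma visits_split_leaf (A : set (curve R)) c D lo hi :
  (visits (split_leaf A c D) lo hi <= 7)%N.
Proof.
rewrite /split_leaf; case: (_ \in D); case: (_ \in D) => //=.
all: by do ?case: ifP => _ /=.
Qed.

Lemma visits_insert s a G lo hi :
  (visits (insert_curve [set` a :: s] a G) lo hi <=
   visits G lo hi + 6 * count (hit a) (visited G lo hi))%N.
Proof.
elim: G lo hi => [D|D e l IHl r IHr|D c u IHu d IHd] lo hi /=.
- rewrite addn0 /hit /=; case: eqP => //= _; exact: visits_split_leaf.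
- case: ifP => _; last by case: ifP => _; rewrite addSn ltnS.
  by rewrite count_cat mulnDr addSn ltnS addnACA leq_add.
- by rewrite count_cat mulnDr addSn ltnS addnACA leq_add.
Qed.

Lemma leaf_ok_cons s a l : a \notin s -> leaf_ok s l -> ~~ hit a l -> leaf_ok (a :: s) l.
Proof.
move=> as_ [E|[h1 [bd tD] h3 h4]]; first by left.
rewrite /hit negbK => /eqP Da; right; split => //; last by move=> w /h4; exact: wall_ok_cons.
by exists bd; exact: trapezoid_cons.
Qed.

Lemma refine_ok s a l : generic (a :: s) -> a \notin s -> leaf_ok s l ->
  (forall l', l' \in refine s a l -> leaf_ok (a :: s) l' /\ region l' `<=` region l) /\
  pairwise disjoint_leaves (refine s a l).
Proof.
case: l => D [lo hi] gs as_ lok; rewrite /refine.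
case: ifPn => [hl|nh]; last first.
  by split => // l; rewrite inE => /eqP->; split => //; exact: leaf_ok_cons.
have [[x y] [/= Dxy [/= sx ey]]] : D `&` graph a !=set0 by apply/set0P.
rewrite ey in Dxy; case: lok => [/= E|/= [h1 [bd tD] h3 h4]].
  by rewrite E in Dxy.
have [f1 f2] := refine_fine gs as_ h1 tD h3 h4 sx Dxy.
by split => // l /f1 [k1 k2]; split => // z /k2.
Qed.

Definition good_leaves s (L : seq leaf) : Prop :=
  (forall l, l \in L -> leaf_ok s l) /\ pairwise disjoint_leaves L.

Lemma good_refine s a L : generic (a :: s) -> a \notin s -> good_leaves s L ->
  good_leaves (a :: s) (flatten (map (refine s a) L)).
Proof.
move=> gs as_ [ok pw]; split.
  move=> l' /flatten_mapP [l lL ll']; exact: ((refine_ok gs as_ (ok l lL)).1 l' ll').1.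
elim: L ok pw => //= l L IH ok /andP[al pw].
have okl := refine_ok gs as_ (ok l (mem_head _ _)).
have okL l' : l' \in L -> leaf_ok s l' by move=> l'L; apply: ok; rewrite inE l'L orbT.
rewrite pairwise_cat okl.2 IH // !andbT; apply/allrelP => l1 l2 /okl.1 [_ s1].
case/flatten_mapP => l' l'L /(refine_ok gs as_ (okL _ l'L)).1 [_ s2].
have /asboolP dj := allP al _ l'L.
by apply/asboolP => z /s1 h1 /s2; exact: dj.
Qed.

Lemma good_history s : uniq s -> generic s -> good_leaves s (visited (history_rev s) -oo +oo)%E.
Proof.
elim: s => [_ _|a s IH /= /andP[as_ us] gs] /=.
  split => // l; rewrite inE => /eqP->; right; split => //=.
  - by exists (fun=> None); exact: trapezoid_setT.
  - by move=> w [].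
rewrite visited_insert; apply: good_refine => //; apply: IH => //.
by apply: generic_sub gs => c cs; rewrite inE cs orbT.
Qed.

(** * Original walls and charges *)

Definition ends s : seq (curve R * bool) :=
  [seq (c, b) | c <- s, b <- [:: false; true]].

(** The range excludes the height of [e] and includes that of [u], so [u] itself must pass the age
    test in [crosses]. *)
Definition separates e u c : bool :=
  spans c (endpoint e).1 &&
  (((endpoint e).2 < height c (endpoint e).1 <= height u (endpoint e).1) ||
   (height u (endpoint e).1 <= height c (endpoint e).1 < (endpoint e).2)).

(* The original wall of [e] reached [u].  The list starts with the youngest
   curve, so a smaller index means a younger curve. *)
Definition crosses s e u : bool :=
  [&& e.1 \in s, u \in s, spans u (endpoint e).1,
      height u (endpoint e).1 != (endpoint e).2 &
      all (fun c => separates e u c ==> (index c s < index e.1 s)%N) s].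

Definition new_crossings a s : nat :=
  count (fun e => crosses (a :: s) e a) (ends s).

(* The endpoint [(a, b)] falls into a trapezoid that the original wall of [e]
   traversed, [u] being the last curve between [e] and the trapezoid. *)
Definition stale s b e u a : Prop :=
  exists D bd up, [/\ trapezoid s D bd, D (endpoint (a, b)),
    bd up = Some u /\ dir_lt up (height u (endpoint e).1) (endpoint e).2,
    (exists y, D ((endpoint e).1, y)) & dir_lt (~~ b) (endpoint e).1 (endpoint (a, b)).1].

Definition stale_crossings b a s : nat :=
  (\sum_(u <- s) count (fun e => crosses s e u && `[< stale s b e u a >]) (ends s))%N.

Lemma mem_ends s e : (e \in ends s) = (e.1 \in s).
Proof.
case: e => c b; apply/allpairsP/idP => [[[c' b'] [/= ? _ [-> _]]]//|cs].
by exists (c, b); split => //; case: (b).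
Qed.

Lemma height_endpoint e : height e.1 (endpoint e).1 = (endpoint e).2.
Proof. by case: e => c []. Qed.

Lemma spans_endpoint e : spans e.1 (endpoint e).1.
Proof. by have [] := graph_endpoint e. Qed.

Lemma inside_endpoint e : ~~ inside e.1 (endpoint e).1.
Proof. by case: e => c []; rewrite /inside /= ltxx ?andbF. Qed.

Lemma separated_inside s e c : generic s -> e.1 \in s -> c \in s ->
  spans c (endpoint e).1 -> height c (endpoint e).1 != (endpoint e).2 ->
  inside c (endpoint e).1.
Proof.
move=> [g1 _] es cs /andP[h1 h2] ne.
have N b : (endpoint (c, b)).1 != (endpoint e).1.
  apply: contraNneq ne => h; rewrite -h (height_endpoint (c, b)).
  by rewrite (g1 (c, b) e cs es h).
by rewrite /inside !lt_neqAle h1 h2 (N false) eq_sym (N true).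
Qed.

(** The conditions on a leaf concern its open interval; this supplies an abscissa just inside the
    wall and before a limit [r]. *)
Lemma near_wall (lo hi : \bar R) b (w r : R) : (lo < hi)%E ->
  w%:E = (if b then lo else hi) -> dir_lt b w r ->
  exists x : R, [/\ (lo < x%:E < hi)%E, dir_lt b w x & dir_lt b x r].
Proof.
case: b => /= lohi ew wr; rewrite -ew in lohi *; move: lohi.
- case: hi {ew} => [h| |] //=; rewrite ?lte_fin => wh.
    exists ((w + Num.min h r) / 2); rewrite !lte_fin /Num.min.
    by case: (ltP h r) => *; split; lra.
  by exists ((w + r) / 2); rewrite ltry lte_fin; split; lra.
- case: lo {ew} => [h| |] //=; rewrite ?lte_fin => wh.
    exists ((w + Num.max h r) / 2); rewrite !lte_fin /Num.max.
    by case: (ltP h r) => *; split; lra.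
  by exists ((w + r) / 2); rewrite ltNyr lte_fin; split; lra.
Qed.

(** Equal keys would contradict disjointness, so the keys are distinct and inject into [cand]. *)
Lemma count_keys (K : eqType) (P : pred leaf) (key : leaf -> K) L (cand : seq K) :
  pairwise disjoint_leaves L ->
  (forall l l', l \in L -> l' \in L -> P l -> P l' -> key l = key l' ->
     ~~ disjoint_leaves l l') ->
  (forall l, l \in L -> P l -> key l \in cand) -> (count P L <= size cand)%N.
Proof.
move=> pw inj sub; rewrite -size_filter -(size_map key); apply: uniq_leq_size.
  rewrite uniq_pairwise pairwise_map.
  apply: (sub_in_pairwise (P := fun l => (l \in L) && P l)
            (r := disjoint_leaves)); last 2 first.
  - by apply/allP => l; rewrite mem_filter andbC.
  - exact: subseq_pairwise (filter_subseq _ _) pw.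
  move=> l l' /andP[lL Pl] /andP[l'L Pl'] dj /=; apply/eqP => kk.
  by have := inj _ _ lL l'L Pl Pl' kk; rewrite dj.
by move=> k /mapP [l]; rewrite mem_filter => /andP[Pl lL] ->; apply: sub.
Qed.

Lemma count_cover (T : eqType) (p : pred T) (qs : seq (pred T)) (r : seq T) :
  {in r, forall x, p x -> has (@^~ x) qs} ->
  (count p r <= \sum_(q <- qs) count q r)%N.
Proof.
elim: qs p => [|q qs IH] p h; rewrite ?big_nil ?big_cons.
  by rewrite leqn0 eqn0Ngt -has_count; apply/hasPn => x xr; apply/negP => /(h x xr).
apply: (@leq_trans (count q r + count (predI p (predC q)) r)%N).
  by elim: (r) => //= x r' IHr; case: (p x); case: (q x); rewrite /=; lia.
rewrite leq_add2l; apply: IH => x xr /andP[px /negbTE qx].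
by have := h x xr px; rewrite /= qx.
Qed.

Lemma dir_lt_exists b (w : R) : exists r, dir_lt b w r.
Proof. by case: b; [exists (w + 1)|exists (w - 1)]; rewrite /=; lra. Qed.

(** * Charging the leaves hit by a new curve *)

Section Hits.
Variables (s : seq (curve R)) (a : curve R) (L : seq leaf).
Hypothesis gs : generic (a :: s).
Hypothesis as_ : a \notin s.
Hypothesis gL : good_leaves s L.

Let gs' : generic s.
Proof. by apply: generic_sub gs => c cs; rewrite inE cs orbT. Qed.

Let hit_ok l : l \in L -> hit a l ->
  [/\ (l.2.1 < l.2.2)%E,
      exists2 bd, trapezoid s l.1 bd & exists2 x, spans a x & l.1 (x, height a x),
      forall x : R, (l.2.1 < x%:E < l.2.2)%E -> exists y, l.1 (x, y) &
      forall w : R, w%:E = l.2.1 \/ w%:E = l.2.2 -> wall_ok s (region l) w].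
Proof.
move=> lL /set0P [[x y] [Dxy [/= sx ey]]].
case: (gL.1 l lL) => [E|[h1 [bd tD] h2 h3]]; first by rewrite E in Dxy.
by split => //; exists bd => //; exists x => //; rewrite -ey.
Qed.

Let cross_ok l (x : R) : l \in L -> hit a l -> spans a x ->
  (l.2.1 < x%:E < l.2.2)%E -> region l (x, height a x).
Proof.
move=> lL hl sx hx; have [_ [bd tD [x0 sx0 Dx0]] cov _] := hit_ok lL hl.
split => //; have [y Dy] := cov _ hx.
exact: (trap_follow gs as_ tD Dx0 Dy).
Qed.

(** The right end of [a] is excluded so that [a] continues past the left wall into the leaf. *)
Let spanned (l : leaf) := hit a l && ((xl a)%:E <= l.2.1 < (xr a)%:E)%E.

(** The key is the left wall: leaves sharing it overlap on [a] just to its right. Unless it is at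
    [xl a], it belongs to an endpoint whose original wall [a] meets. *)
Let spanned_le : (count spanned L <= (new_crossings a s).+1)%N.
Proof.
pose cand := (xl a)%:E :: [seq (endpoint e).1%:E | e <- ends s & crosses (a :: s) e a].
have -> : (new_crossings a s).+1 = size cand by rewrite /= size_map size_filter.
apply: (count_keys (key := fun l => l.2.1) gL.2).
  move=> l l' lL l'L /andP[hl /andP[h1 h2]] /andP[hl' _] /= E.
  case ew : l.2.1 h1 h2 => [w| |] //; rewrite lee_fin lte_fin => h1 h2.
  have [lt1 _ _ _] := hit_ok lL hl; have [lt2 _ _ _] := hit_ok l'L hl'.
  have [x1 [x1P /= wx1 x1r]] := near_wall (b := true) lt1 (esym ew) h2.
  have [x2 [x2P /= wx2 x2r]] := near_wall (b := true) lt2 (esym (etrans (esym E) ew)) wx1.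
  have sx2 : spans a x2 by apply/andP; split; lra.
  apply/asboolPn => dj; apply: (dj (x2, height a x2)); apply: cross_ok => //.
  case/andP: x1P x2P => k1 k2 /andP[k3 k4]; rewrite E k3 /=.
  by apply: lt_trans k2; rewrite lte_fin.
move=> l lL /andP[hl /andP[h1 h2]]; rewrite /cand inE.
case ew : l.2.1 h1 h2 => [w| |] //; rewrite lee_fin lte_fin eqe => h1 h2.
case: (eqVneq w (xl a)) => //= wa.
have ia : inside a w by rewrite /inside h2 lt_neqAle eq_sym wa h1.
have [lt1 _ _ wok] := hit_ok lL hl.
have [e [es we he]] := wok w (or_introl (esym ew)).
apply/mapP; exists e; last by rewrite we.
rewrite mem_filter mem_ends es andbT.
have ea : e.1 != a by apply: contraNneq as_ => <-.
have ne : height a (endpoint e).1 != (endpoint e).2.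
  rewrite -(height_endpoint e) eq_sym; apply: (gs.2 e.1 a) => //; rewrite ?mem_head //.
  - by rewrite inE es orbT.
  - exact: spans_endpoint.
  - by rewrite -we.
rewrite /crosses inE es orbT mem_head ne -we (inside_spans ia) /=.
rewrite eqxx eq_sym (negbTE ea) /= implybT /=; apply/allP => c cs; apply/implyP.
have ca : c != a by apply: contraNneq as_ => <-.
rewrite eq_sym (negbTE ca) ltnS /separates -we => /andP[sc sep].
(* Suppose [c] separates [e] from [a] and is at least as old as the curve of [e]. Just right of the
   wall the leaf lies on the side of [c] where [e] is, while [a], running in the leaf, lies on the
   other. *)
rewrite ltnNge; apply/negP => ic.
pose up := (endpoint e).2 < height c w.
have nec : height c w != (endpoint e).2 by case/orP: sep => /andP[]; lra.
have ic' : inside c w by rewrite we; apply: (separated_inside gs') => //; rewrite -we.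
have be : beyond up c (endpoint e).
  rewrite /beyond -we sc /= /up; move: nec; rewrite neq_lt.
  by case: (ltP (endpoint e).2 (height c w)) => //= _; rewrite orbF.
have /andP[_ h3] := ia; have /andP[_ h4] := ic'.
have hm : w < Num.min (xr a) (xr c) by rewrite /Num.min; case: ifP.
have [x [xP /= wx xm]] := near_wall (b := true) lt1 (esym ew) hm.
have {}xm : x < xr a /\ x < xr c.
  by move: xm; rewrite /Num.min; case: (ltP (xr a) (xr c)) => *; split; lra.
have ix : inside a x by rewrite /inside; lra.
have sx : spans c x by move: sc ic'; rewrite /spans /inside; lra.
have rz := cross_ok lL hl (inside_spans ix) xP.
have /andP[_ /= bz] := he c _ up cs ic rz sx be.
have lt : dir_lt up (height c w) (height a w).
  have := gs.2 c a w; rewrite mem_head inE cs orbT ca sc ia => /(_ isT isT isT isT isT).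
  by move: sep; rewrite neq_lt /up; case: (ltP (endpoint e).2 (height c w)) => /= *; lra.
have := nocross gs _ (mem_head _ _) ca sc sx ia ix lt; rewrite inE cs orbT => /(_ isT).
by clear ew; move: bz; case: (up) => /= *; lra.
Qed.

Let containing (l : leaf) := hit a l && (l.2.1 < (xl a)%:E < l.2.2)%E.

(** All these leaves contain the left endpoint of [a], so a single dummy key suffices. *)
Let containing_le : (count containing L <= 1)%N.
Proof.
apply: (count_keys (key := fun=> tt) (cand := [:: tt]) gL.2) => // l l' lL l'L.
have sa : spans a (xl a) by rewrite /spans lexx ltW // xl_lt_xr.
move=> /andP[hl h] /andP[hl' h'] _; apply/asboolPn => dj.
by apply: (dj (lpoint a)); exact: cross_ok.
Qed.

(* The bound of the interval of [l] facing the endpoint [(a, b)]. *)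
Let facing b (l : leaf) : \bar R := if b then l.2.1 else l.2.2.

(** The trapezoid is hit, but its visited part lies entirely past the end [b] of [a]. *)
Let beside b (l : leaf) :=
  hit a l && (if b then (xr a)%:E <= l.2.1 else l.2.2 <= (xl a)%:E)%E.

Let beside_ok b l : l \in L -> beside b l ->
  exists w, [/\ facing b l = w%:E, l.1 (endpoint (a, b)),
    dir_lt (~~ b) w (endpoint (a, b)).1 & exists y, l.1 (w, y)].
Proof.
move=> lL /andP[hl hb]; have [lt [bd tD [x0 sx0 Dx0]] cov wok] := hit_ok lL hl.
have [w ew] : exists w, facing b l = w%:E.
  move: lt hb; rewrite /facing; case: (l) => D [lo hi] /=; case: b => /=.
    by case: lo hi => [lo| |] [hi| |] //; exists lo.
  by case: hi lo => [hi| |] [lo| |] //; exists hi.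
have [r wr] : exists r, dir_lt b w r.
  exact: dir_lt_exists.
have [x [xP wx _]] := near_wall lt (esym ew) wr.
have [y Dxy] := cov _ xP.
have wle : if b then xr a <= w else w <= xl a.
  by move: hb ew; rewrite /facing; case: (b) => h E; rewrite -lee_fin -E.
have [ha1 ha2] := andP sx0.
have Dp : l.1 (endpoint (a, b)).
  have lxr := xl_lt_xr a.
  have [y' Dy'] : exists y', l.1 ((endpoint (a, b)).1, y').
    clear ew; move: wx wle; case: (b) => /= wx wle.
      by apply: (trap_convex tD Dx0 Dxy) => /=; lra.
    by apply: (trap_convex tD Dxy Dx0) => /=; lra.
  rewrite (surjective_pairing (endpoint (a, b))) -(height_endpoint (a, b)).
  apply: (trap_follow gs as_ tD Dx0 Dy' sx0); exact: spans_endpoint (a, b).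
have wk : wall_ok s (region l) w.
  by apply: wok; rewrite -ew /facing; case: (b); [left|right].
have wp := wall_ok_neq gs tD Dp wk.
have wlt : dir_lt (~~ b) w (endpoint (a, b)).1.
  by clear ew; move: wle wp; case: (b) => /=; rewrite neq_lt => h /orP[]; lra.
exists w; split => //.
rewrite (surjective_pairing (endpoint (a, b))) in Dp.
clear ew; move: wx wlt Dp; case: (b) => /= wx wlt Dp.
  by apply: (trap_convex tD Dp Dxy) => /=; lra.
by apply: (trap_convex tD Dxy Dp) => /=; lra.
Qed.

(** Leaves with the same facing wall have the endpoint of [a] in both trapezoids, which forces them
    to overlap just past the wall. The pair charged is the endpoint [e] of the wall with the bound
    [u] of the trapezoid towards [e]. *)
Let beside_le b : (count (beside b) L <= stale_crossings b a s)%N.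
Proof.
pose cand := flatten [seq [seq (endpoint e).1%:E | e <- ends s &
  crosses s e u && `[< stale s b e u a >]] | u <- s].
have -> : stale_crossings b a s = size cand.
  rewrite size_flatten sumnE /shape -map_comp big_map; apply: eq_bigr => u _.
  by rewrite /= size_map size_filter.
apply: (count_keys (key := facing b) gL.2).
  move=> l l' lL l'L bl bl' E.
  have [w [ew Dp wp _]] := beside_ok lL bl.
  have [w' [ew' D'p _ _]] := beside_ok l'L bl'.
  have ww : w' = w by move: E; rewrite ew ew' => -[].
  rewrite ww {ww} in ew'.
  have [lt [bd tD _] cov _] := hit_ok lL (andP bl).1.
  have [lt' [bd' tD' _] cov' _] := hit_ok l'L (andP bl').1.
  have [r wr] : exists r, dir_lt b w r.
    exact: dir_lt_exists.
  have [x1 [x1P wx1 _]] := near_wall lt (esym ew) wr.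
  have [x [xP wx xx1]] := near_wall lt' (esym ew') wx1.
  have xP' : (l.2.1 < x%:E < l.2.2)%E.
    move: ew x1P; rewrite /facing; move: wx xx1; case: (b) => /= wx xx1 ew /andP[k1 k2].
      by rewrite ew lte_fin wx (lt_trans _ k2) // lte_fin.
    by rewrite ew lte_fin wx (lt_trans k1) // lte_fin.
  have [y Dxy] := cov _ xP'; have [y' D'xy] := cov' _ xP.
  apply/asboolPn => dj; apply: (dj (x, y)); split => //.
  apply: (trap_full tD' D'xy) => up.
  have := trap_bound tD' up D'p; have := trap_bound tD' up D'xy.
  case eu : (bd' up) => [u|] //= /andP[iu _] /andP[iu' hu].
  have us := trap_mem tD' eu.
  have bp : beyond up u (endpoint (a, b)) by rewrite /beyond (inside_spans iu').
  have /andP[_ /=] := trap_same_side gs' tD us Dp Dxy (inside_spans iu) bp.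
  by rewrite iu.
move=> l lL bl; have [w [ew Dp wp [y Dwy]]] := beside_ok lL bl.
have [lt [bd tD _] cov wok] := hit_ok lL (andP bl).1.
have [|e [es we he]] := wok w.
  by rewrite -ew /facing; case: (b); [left|right].
have ney : (endpoint e).2 != y.
  apply/eqP => E; apply: (trap_graph tD es (graph_endpoint e)).
  by rewrite (surjective_pairing (endpoint e)) -we E.
pose up := y < (endpoint e).2.
have be : beyond up e.1 (w, y).
  rewrite /beyond /= we height_endpoint spans_endpoint /= /up.
  by move: ney; rewrite neq_lt; case: (ltP y (endpoint e).2) => //=; rewrite orbF.
have [u [eu us iu hu nu]] := trap_gap tD es Dwy be.
rewrite /= in iu hu nu; rewrite we height_endpoint -we in nu.
have neu : height u w != (endpoint e).2.
  have ue : e.1 != u by apply: contraTneq iu => <-; rewrite we inside_endpoint.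
  rewrite -height_endpoint -we eq_sym; apply: (gs'.2 _ _ _ es us ue) => //.
  by rewrite we spans_endpoint.
have ltu : dir_lt up (height u w) (endpoint e).2.
  by clear eu ew; move: neu nu; rewrite neq_lt; case: (up) => /= /orP[]; lra.
apply/flatten_mapP; exists u => //; apply/mapP; exists e; last by rewrite ew we.
rewrite mem_filter mem_ends es andbT; apply/andP; split; last first.
  apply/asboolP; exists l.1, bd, up; rewrite -we; split => //.
  by exists y.
rewrite /crosses es us -we (inside_spans iu) neu /=; apply/allP => c cs; apply/implyP.
rewrite /separates -we => /andP[sc sep].
(* At the wall, [c] lies between [e] and [u]. If it were at least as old as the curve of [e], then
   just past the wall the leaf would lie between [c] and [u], so [c] would have to cross [u]. *)
rewrite ltnNge; apply/negP => ic.
have nec : height c w != (endpoint e).2 by clear eu ew; case/orP: sep => /andP[]; lra.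
have ic' : inside c w by rewrite we; apply: (separated_inside gs') => //; rewrite -we.
have bce : beyond (~~ up) c (endpoint e).
  rewrite /beyond -we sc /=; clear eu ew.
  by move: sep ltu; case: (up) => /= /orP[] /andP[]; lra.
have lec : ~~ dir_lt up (height c w) (height u w).
  by clear eu ew; move: sep ltu; case: (up) => /= /orP[] /andP[]; lra.
have [r wr rc] : exists2 r, dir_lt b w r & if b then r = xr c else r = xl c.
  by case/andP: ic' => ? ?; case: (b); [exists (xr c)|exists (xl c)].
have [x [xP wx xr_]] := near_wall lt (esym ew) wr.
have [y' Dxy] := cov _ xP.
have sx : spans c x.
  by clear eu ew; move: rc ic' wx xr_; rewrite /spans /inside; case: (b) => /= ->; lra.
have := trap_bound tD up Dxy; rewrite eu /= => /andP[iux hux].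
have /andP[_ /= bz] := he c (x, y') (~~ up) cs ic (conj Dxy xP) sx bce.
have ltx : dir_lt up (height c x) (height u x).
  by clear eu ew; move: bz hux; case: (up) => /= *; lra.
case: (eqVneq c u) => [cu|cu].
  by move: ltx; rewrite cu; case: (up); rewrite /= ltxx.
by have := nocross gs' cs us cu sx sc iux iu ltx; rewrite (negbTE lec).
Qed.

(** The 2 accounts for a wall at [xl a] and for the leaf whose open interval contains [xl a]. *)
Lemma hits_le : (count (hit a) L <=
  new_crossings a s + stale_crossings false a s + stale_crossings true a s + 2)%N.
Proof.
have h : {in L, forall l, hit a l ->
    has (@^~ l) [:: spanned; containing; beside false; beside true]}.
  move=> l _ hl; rewrite /= orbF /spanned /containing /beside hl /=.
  case: (leP l.2.2 (xl a)%:E) => h1; rewrite ?orbT //.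
  case: (leP (xr a)%:E l.2.1) => h2; rewrite ?orbT //= !orbF !andbT.
  by case: leP.
apply: leq_trans (count_cover h) _; rewrite !big_cons big_nil addn0.
apply: leq_trans (leq_add spanned_le (leq_add containing_le
  (leq_add (beside_le false) (beside_le true)))) _.
lia.
Qed.

End Hits.

(** * Backward analysis for a fixed ordering *)

Definition crossings s : nat :=
  (\sum_(u <- s) count (fun e => crosses s e u) (ends s))%N.

Lemma crosses_older s e u : crosses s e u -> (index u s < index e.1 s)%N.
Proof.
case/and5P=> es us su ne /allP /(_ u us) /implyP; apply.
by rewrite /separates su !lexx andbT /= -neq_lt eq_sym.
Qed.

(** Walls of [a] add no pair, since no curve is younger than [a]; every other pair is old or has [a]
    as its second member. *)
Lemma crossings_cons a s : a \notin s ->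
  (crossings (a :: s) <= crossings s + new_crossings a s)%N.
Proof.
move=> as_; rewrite /crossings big_cons addnC.
have ends_cons u : (count (fun e => crosses (a :: s) e u) (ends (a :: s)) =
    count (fun e => crosses (a :: s) e u) (ends s))%N.
  have F b : crosses (a :: s) (a, b) u = false.
    by apply/negbTE/negP => /crosses_older; rewrite /= eqxx ltn0.
  by rewrite /= !F.
rewrite ends_cons leq_add2r; under eq_bigr => u _ do rewrite ends_cons.
rewrite !big_seq; apply: leq_sum => u us; rewrite -!size_filter.
have h e : e \in ends s -> crosses (a :: s) e u -> crosses s e u.
  rewrite mem_ends => es /and5P[_ _ h1 h2 /allP h3]; rewrite /crosses es us h1 h2 /=.
  apply/allP => c cs; have := h3 c; rewrite inE cs orbT => /(_ isT) /=.
  have N x : x \in s -> a == x = false by move=> xs; apply: contraNF as_ => /eqP ->.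
  by rewrite !N // ltnS.
rewrite !size_filter -!sum1_count [X in (X <= _)%N]big_mkcond [X in (_ <= X)%N]big_mkcond /=.
rewrite !big_seq; apply: leq_sum => e /h; case: ifP => // _ /(_ isT) ->; by [].
Qed.

Lemma count_exchange (T T' : Type) (P : T -> T' -> bool) (r : seq T) (r' : seq T') :
  (\sum_(x <- r) count (P x) r' = \sum_(y <- r') count (P^~ y) r)%N.
Proof.
under eq_bigr => x _ do rewrite -sum1_count big_mkcond.
under [RHS]eq_bigr => y _ do rewrite -sum1_count big_mkcond.
exact: exchange_big.
Qed.

Lemma count_uniq_sub (T : eqType) (p : pred T) (r r' : seq T) :
  uniq r -> {subset r <= r'} -> (count p r <= count p r')%N.
Proof.
move=> ur sub; rewrite -!size_filter; apply: uniq_leq_size; first exact: filter_uniq.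
by move=> x; rewrite !mem_filter => /andP[-> /sub].
Qed.

Lemma count_le1 (T : eqType) (p : pred T) (r : seq T) : uniq r ->
  (forall x y, x \in r -> y \in r -> p x -> p y -> x = y) -> (count p r <= 1)%N.
Proof.
move=> ur h; rewrite -size_filter.
case E : [seq x <- r | p x] => [|x r'] //.
have xr : x \in [seq x <- r | p x] by rewrite E mem_head.
rewrite -E; apply: (@uniq_leq_size _ _ [:: x]); first exact: filter_uniq.
move: xr; rewrite mem_filter => /andP[px xr] y; rewrite mem_filter inE => /andP[py yr].
by apply/eqP; exact: h.
Qed.

Lemma index_rem_lt (T : eqType) (r : seq T) (a x y : T) : x != a -> y != a ->
  (index x (rem a r) < index y (rem a r))%N = (index x r < index y r)%N.
Proof.
move=> xa ya; elim: r => //= t r IH; case: (eqVneq t a) => [->|ta] /=.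
  by rewrite ![a == _]eq_sym (negbTE xa) (negbTE ya) ltnS.
case: (t == x); case: (t == y) => //.
Qed.

Lemma uniq_ends s : uniq s -> uniq (ends s).
Proof. by move=> us; apply: allpairs_uniq => // -[? ?] [? ?] _ _ /= [-> ->]. Qed.

Lemma size_ends s : size (ends s) = (size s * 2)%N.
Proof. by rewrite size_allpairs. Qed.

Lemma sub_ends s s' : {subset s <= s'} -> {subset ends s <= ends s'}.
Proof. by move=> sub e; rewrite !mem_ends; exact: sub. Qed.

Lemma mem_rem_cons s a c : uniq s -> a \in s -> c \in s -> c \in a :: rem a s.
Proof. by move=> us as_ cs; rewrite -(perm_mem (perm_to_rem as_)). Qed.


(** Fix [e]. If [a] is younger than the curve of [e], the pair already crosses in [s]. Otherwise
    there is at most one such [a] above [e] and one below; with two endpoints per curve this gives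
    the 4. *)
Lemma sum_new_crossings s : uniq s -> generic s ->
  (\sum_(a <- s) new_crossings a (rem a s) <= crossings s + 4 * size s)%N.
Proof.
move=> us gs.
apply: (@leq_trans (\sum_(a <- s) count (fun e => crosses (a :: rem a s) e a) (ends s))%N).
  apply: leq_sum => a _; apply: count_uniq_sub; first exact/uniq_ends/rem_uniq.
  by apply: sub_ends => c /mem_rem.
rewrite count_exchange /crossings [X in (_ <= X + _)%N]count_exchange.
have -> : (4 * size s = \sum_(e <- ends s) 2)%N.
  by rewrite big_const_seq count_predT iter_addn_0 size_ends; lia.
rewrite -big_split /=; apply: leq_sum => e _.
pose late a := [&& a \in s, crosses (a :: rem a s) e a & (index e.1 s <= index a s)%N].
pose late_at up a := late a && dir_lt up (endpoint e).2 (height a (endpoint e).1).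
have : (count (fun a => crosses (a :: rem a s) e a) s <=
    \sum_(q <- [:: crosses s e; late_at true; late_at false]) count q s)%N.
  apply: count_cover => a as_ /= ca; rewrite orbF.
  case: (leqP (index e.1 s) (index a s)) => [le|lt].
    rewrite /late_at /late as_ ca le /=; case/and5P: ca => _ _ _ + _.
    by rewrite neq_lt => /orP[] ->; rewrite ?orbT.
  have ea : e.1 != a by apply: contraTneq lt => ->; rewrite ltnn.
  have -> //: crosses s e a.
  case/and5P: ca => es _ h1 h2 /allP h3.
  have es' : e.1 \in s by move: es; rewrite inE (negbTE ea) => /mem_rem.
  rewrite /crosses as_ es' h1 h2 /=; apply/allP => c cs; apply/implyP => sep.
  case: (eqVneq c a) => [->//|ca].
  have := h3 c (mem_rem_cons us as_ cs); rewrite sep /=.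
  rewrite ![a == _]eq_sym (negbTE ca) (negbTE ea) ltnS.
  by rewrite index_rem_lt.
move=> /leq_trans; apply; rewrite !big_cons big_nil addn0 leq_add2l -[2%N]/(1 + 1)%N.
have one up : (count (late_at up) s <= 1)%N; last exact: leq_add.
apply: count_le1 => // a a' _ _.
move=> /andP[/and3P[as_ ca ia] ha] /andP[/and3P[as_' ca' ia'] ha'].
(* If [c'] were nearer to [e], it would separate [e] from [c] although it is not younger than the
   curve of [e]. Used both ways, this excludes two distinct late curves on one side. *)
have N c c' : c \in s -> c' \in s -> crosses (c :: rem c s) e c ->
   crosses (c' :: rem c' s) e c' -> c != c' ->
   dir_lt up (endpoint e).2 (height c (endpoint e).1) ->
   dir_lt up (endpoint e).2 (height c' (endpoint e).1) ->
   (index e.1 s <= index c' s)%N ->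
   dir_lt up (height c (endpoint e).1) (height c' (endpoint e).1).
  move=> cs c's cc cc' ncc' hc hc' ic'.
  have e1 : e.1 \in s by case/and5P: cc => + _ _ _ _; rewrite inE => /predU1P [->|/mem_rem].
  have [_ _ sc nc /allP hall] := and5P cc; have [_ _ sc' nc' _] := and5P cc'.
  have i' := separated_inside gs e1 c's sc' nc'.
  have ne := gs.2 c c' _ cs c's ncc' sc i'.
  case: (boolP (dir_lt up (height c' (endpoint e).1) (height c (endpoint e).1)))
    => [lt|]; last first.
    by move: ne; rewrite neq_lt; case: (up) => /= /orP[]; lra.
  have nec : e.1 != c.
    apply: contraTneq (inside_spans (separated_inside gs e1 cs sc nc)) => E.
    by have := inside_endpoint e; rewrite {1}E (separated_inside gs e1 cs sc nc).
  have c'c : c' != c by rewrite eq_sym.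
  have := hall c' (mem_rem_cons us cs c's).
  rewrite /= ![c == _]eq_sym (negbTE nec) (negbTE c'c) ltnS index_rem_lt //.
  rewrite ltnNge ic' implybF => /negP; case; rewrite /separates sc' /=.
  by move: lt hc'; case: (up) => /= *; apply/orP; [left|right]; lra.
apply/eqP; apply/negP => /negP na.
have := N a a' as_ as_' ca ca' na ha ha' ia'.
rewrite eq_sym in na; have := N a' a as_' as_ ca' ca na ha' ha ia.
by case: (up) => /= *; lra.
Qed.

(** If the endpoint of [a] came strictly between [x] and that of [a'], it would share a column with
    [D']. Both trapezoids have the bound [u], and the opposite bound of [D'] cannot come between
    this endpoint and [u]. So the endpoint lies in [D'], which avoids [a]. *)
Lemma stale_disjoint s b u up a a' x D D' bd bd' : uniq s -> a \in s -> a != a' ->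
  trapezoid (rem a s) D bd -> D (endpoint (a, b)) -> bd up = Some u ->
  trapezoid (rem a' s) D' bd' -> D' (endpoint (a', b)) -> bd' up = Some u ->
  (exists y, D' (x, y)) -> dir_lt (~~ b) x (endpoint (a, b)).1 ->
  ~~ dir_lt (~~ b) (endpoint (a, b)).1 (endpoint (a', b)).1.
Proof.
move=> us as_ aa tD Dp bu tD' Dp' bu' [y Dy] hx; apply/negP => hx'.
set p := endpoint (a, b) in Dp hx hx' *.
have ap : a \in rem a' s by rewrite mem_rem_uniq // inE aa.
apply: (trap_graph tD' ap (graph_endpoint (a, b))); rewrite -/p.
have [t Dt] : exists t, D' (p.1, t).
  rewrite (surjective_pairing (endpoint (a', b))) in Dp'; clear bu bu'.
  move: hx hx' Dp'; rewrite /p; case: (b) => /= hx hx' Dp'.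
    have [|t Dt] := trap_convex tD' Dp' Dy (x := xr a); last by exists t.
    by rewrite /=; lra.
  have [|t Dt] := trap_convex tD' Dy Dp' (x := xl a); last by exists t.
  by rewrite /=; lra.
rewrite (surjective_pairing p); apply: (trap_full tD' Dt) => up'.
have := trap_bound tD' up' Dt; case: (eqVneq up' up) => [->|ne].
  rewrite bu' /= => /andP[-> _] /=.
  by have := trap_bound tD up Dp; rewrite bu => /andP[].
have -> : up' = ~~ up by move: ne; case: (up); case: (up').
case ev : (bd' (~~ up)) => [v|] //= /andP[iv hv]; rewrite iv /=.
have vs : v \in rem a s.
  rewrite mem_rem_uniq // inE (mem_rem (trap_mem tD' ev)) andbT.
  by apply: contraTneq iv => ->; exact: inside_endpoint (a, b).
apply/negP => /negP nv.
have nev : height v p.1 != p.2.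
  apply/eqP => E; apply: (trap_avoid tD vs (inside_spans iv)).
  by rewrite E -surjective_pairing.
have bv : beyond up v p.
  rewrite /beyond (inside_spans iv) /=; clear bu bu' ev.
  by move: nv nev; rewrite neq_lt; case: (up) => /= + /orP[]; lra.
have [u0 [bu0 _ _ _]] := trap_gap tD vs Dp bv.
move: bu0; rewrite bu => -[<-].
have := trap_bound tD' up Dt; rewrite bu' => /andP[_ /=]; clear bu bu' ev.
by move: hv; case: (up) => /= *; lra.
Qed.

(** By the previous lemma neither endpoint is strictly nearer to the wall, so distinct [a] and [a']
    would share it, and [D'] would contain a point of [a]. *)
Lemma stale_unique s b e u a a' : uniq s -> generic s -> a \in s -> a' \in s ->
  stale (rem a s) b e u a -> stale (rem a' s) b e u a' -> a = a'.
Proof.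
move=> us gs as_ as_'.
move=> [D [bd [up [tD Dp [bu hu] Dy hp]]]] [D' [bd' [up' [tD' Dp' [bu' hu'] Dy' hp']]]].
have E : up' = up by clear bu bu'; move: hu hu'; case: (up); case: (up') => //= *; lra.
rewrite E {hu' E} in bu'.
case: (eqVneq a a') => // aa; exfalso; have a'a : a' != a by rewrite eq_sym.
have n1 := stale_disjoint us as_ aa tD Dp bu tD' Dp' bu' Dy' hp.
have n2 := stale_disjoint us as_' a'a tD' Dp' bu' tD Dp bu Dy hp'.
have E : (endpoint (a, b)).1 = (endpoint (a', b)).1.
  by apply/eqP; rewrite eq_le; move: n1 n2; case: (b) => /=; rewrite -!leNgt => -> ->.
have ap : a \in rem a' s by rewrite mem_rem_uniq // inE aa.
apply: (trap_graph tD' ap (graph_endpoint (a, b))).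
by rewrite (gs.1 (a, b) (a', b) as_ as_' E).
Qed.

(** [a] does not reach the abscissa of [e], so restoring it at any age leaves that wall
    unaffected. *)
Lemma stale_crosses s b e u a : uniq s -> a \in s ->
  crosses (rem a s) e u -> stale (rem a s) b e u a -> crosses s e u.
Proof.
move=> us as_ /and5P[es us_ h1 h2 /allP h3] [D [bd [up [_ _ _ _ hp]]]].
have nsa : ~~ spans a (endpoint e).1.
  by move: hp; rewrite /spans; case: (b) => /= *; lra.
rewrite /crosses (mem_rem es) (mem_rem us_) h1 h2 /=; apply/allP => c cs; apply/implyP => sep.
have ca : c != a by apply: contraNneq nsa => <-; case/andP: sep.
have ea : e.1 != a by apply: contraTneq es => ->; rewrite mem_rem_uniq // inE eqxx.
have := h3 c; rewrite mem_rem_uniq // inE ca cs sep => /(_ isT).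
by rewrite /= index_rem_lt.
Qed.

(** Each pair [(e, u)] is charged by at most one [a], and only if it crosses in [s]. *)
Lemma sum_stale_crossings b s : uniq s -> generic s ->
  (\sum_(a <- s) stale_crossings b a (rem a s) <= crossings s)%N.
Proof.
move=> us gs.
pose T a u e := crosses (rem a s) e u && `[< stale (rem a s) b e u a >].
apply: (@leq_trans (\sum_(a <- s) \sum_(u <- s) count (T a u) (ends s))%N).
  rewrite !big_seq; apply: leq_sum => a as_.
  rewrite [X in (_ <= X)%N](big_rem a as_) /=; apply: leq_trans (leq_addl _ _).
  apply: leq_sum => u _; apply: count_uniq_sub; first exact/uniq_ends/rem_uniq.
  by apply: sub_ends => c /mem_rem.
rewrite exchange_big /=; apply: leq_sum => u _.
rewrite (count_exchange (fun a e => T a u e)) -sum1_count [X in (_ <= X)%N]big_mkcond /=.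
apply: leq_sum => e _.
case: (boolP (has (fun a => T a u e) s)) => [/hasP [a as_ /andP[ca /asboolP sa]]|]; last first.
  by rewrite has_count -eqn0Ngt => /eqP ->.
rewrite (stale_crosses us as_ ca sa).
apply: count_le1 => // a1 a2 s1 s2 /andP[_ /asboolP t1] /andP[_ /asboolP t2].
exact: (stale_unique us gs s1 s2 t1 t2).
Qed.

(** * Random orderings *)

Definition perm_sum (T : eqType) (r : seq T) (f : seq T -> nat) : nat :=
  (\sum_(t <- permutations r) f t)%N.

Section PermSum.
Variable T : eqType.
Implicit Types (r t : seq T) (x y : T).

Lemma perm_sum_cons r f : uniq r -> r != [::] ->
  perm_sum r f = (\sum_(x <- r) perm_sum (rem x r) (fun t => f (x :: t)))%N.
Proof.
move=> ur r0; rewrite /perm_sum (perm_big _ (permutationsE _)) /=; last first.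
  by rewrite lt0n size_eq0.
by rewrite big_allpairs_dep undup_id.
Qed.

Lemma rem_rem r x y : uniq r -> rem x (rem y r) = rem y (rem x r).
Proof.
move=> ur; rewrite !rem_filter ?rem_uniq ?filter_uniq // -!filter_predI.
by apply: eq_filter => z /=; rewrite andbC.
Qed.

Lemma sum_rem_exchange r (F : T -> T -> nat) : uniq r ->
  (\sum_(x <- r) \sum_(y <- rem x r) F x y = \sum_(y <- r) \sum_(x <- rem y r) F x y)%N.
Proof.
move=> ur; under eq_bigr => x _ do rewrite rem_filter // big_filter big_mkcond.
under [RHS]eq_bigr => y _ do rewrite rem_filter // big_filter big_mkcond.
rewrite exchange_big /=; apply: eq_bigr => y _; apply: eq_bigr => x _.
by rewrite eq_sym.
Qed.

(* Moving the entry [x] of a random ordering to the front gives a random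
   element followed by a random ordering of the others. *)
Lemma perm_sum_rotate r (g : T -> seq T -> nat) : uniq r ->
  perm_sum r (fun t => \sum_(x <- r) g x (rem x t))%N =
  (size r * \sum_(x <- r) perm_sum (rem x r) (g x))%N.
Proof.
move: {2}(size r) (erefl (size r)) => n.
elim: n r g => [|n IH] r g Er ur.
  by move/size0nil: Er => ->; rewrite /perm_sum /= big_seq1 big_nil.
have r0 : r != [::] by rewrite -size_eq0 Er.
rewrite perm_sum_cons //.
have step y : y \in r ->
    perm_sum (rem y r) (fun t => \sum_(x <- r) g x (rem x (y :: t)))%N =
    (perm_sum (rem y r) (g y) +
     n * \sum_(x <- rem y r) perm_sum (rem x (rem y r)) (fun t => g x (y :: t)))%N.
  move=> yr; have sy : size (rem y r) = n by rewrite size_rem // Er.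
  rewrite -{1}sy -IH ?rem_uniq // /perm_sum -big_split /=; apply: eq_bigr => t _.
  rewrite (big_rem y yr) /= eqxx; congr (_ + _)%N.
  rewrite !big_seq; apply: eq_bigr => x; rewrite mem_rem_uniq // inE => /andP[xy _].
  by rewrite eq_sym (negbTE xy).
rewrite big_seq (eq_bigr _ step) -big_seq big_split /= Er mulSn; congr (_ + _)%N.
rewrite -big_distrr /= sum_rem_exchange //; case: n IH Er step => [|n] IH Er step //.
congr (_ * _)%N; rewrite !big_seq; apply: eq_bigr => x xr.
rewrite [RHS]perm_sum_cons ?rem_uniq //; last by rewrite -size_eq0 size_rem // Er.
by apply: eq_bigr => y _; rewrite rem_rem.
Qed.

Lemma perm_sum_le r f f' : (forall t, perm_eq t r -> (f t <= f' t)%N) ->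
  (perm_sum r f <= perm_sum r f')%N.
Proof.
move=> h; rewrite /perm_sum !big_seq; apply: leq_sum => t.
by rewrite mem_permutations; exact: h.
Qed.

Lemma perm_sum_eq r f f' : (forall t, perm_eq t r -> f t = f' t) ->
  perm_sum r f = perm_sum r f'.
Proof.
move=> h; rewrite /perm_sum !big_seq; apply: eq_bigr => t.
by rewrite mem_permutations; exact: h.
Qed.

Lemma perm_sumD r f f' : perm_sum r (fun t => f t + f' t)%N = (perm_sum r f + perm_sum r f')%N.
Proof. exact: big_split. Qed.

Lemma perm_sum_const r k : uniq r -> perm_sum r (fun=> k) = (k * (size r)`!)%N.
Proof.
move=> ur; rewrite /perm_sum big_const_seq count_predT size_permutations //.
by rewrite iter_addn_0.
Qed.

End PermSum.

(** * Averaging the charges over random orderings *)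

Definition sum_last (g : curve R -> seq (curve R) -> nat) s : nat :=
  (\sum_(a <- s) perm_sum (rem a s) (g a))%N.

Lemma perm_sum_last (g : curve R -> seq (curve R) -> nat) s : uniq s ->
  (size s * sum_last g s = perm_sum s (fun t => \sum_(a <- t) g a (rem a t)))%N.
Proof.
move=> us; rewrite -perm_sum_rotate //; apply: perm_sum_eq => t ts.
by rewrite (perm_big _ ts).
Qed.

Lemma generic_perm s t : perm_eq t s -> generic s -> generic t.
Proof. by move=> ts; apply: generic_sub => c; rewrite (perm_mem ts). Qed.

Lemma sum_last_new s : uniq s -> generic s ->
  (size s * sum_last new_crossings s <= perm_sum s crossings + 4 * size s * (size s)`!)%N.
Proof.
move=> us gs; rewrite perm_sum_last // -perm_sum_const // -perm_sumD.
apply: perm_sum_le => t ts; rewrite -(perm_size ts).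
by apply: sum_new_crossings; [rewrite (perm_uniq ts)|exact: generic_perm gs].
Qed.

Lemma sum_last_stale b s : uniq s -> generic s ->
  (size s * sum_last (stale_crossings b) s <= perm_sum s crossings)%N.
Proof.
move=> us gs; rewrite perm_sum_last //; apply: perm_sum_le => t ts.
by apply: sum_stale_crossings; [rewrite (perm_uniq ts)|exact: generic_perm gs].
Qed.

Lemma notin_perm_rem s t a : uniq s -> perm_eq t (rem a s) -> a \notin t.
Proof. by move=> us ts; rewrite (perm_mem ts) mem_rem_uniq // inE eqxx. Qed.

Lemma perm_sum_crossings s : uniq s -> s != [::] ->
  (perm_sum s crossings <=
   \sum_(a <- s) perm_sum (rem a s) crossings + sum_last new_crossings s)%N.
Proof.
move=> us s0; rewrite perm_sum_cons // /sum_last -big_split /=.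
rewrite !big_seq; apply: leq_sum => a _; rewrite -perm_sumD.
by apply: perm_sum_le => t ts; apply: crossings_cons; apply: notin_perm_rem ts.
Qed.

Definition order_time s : nat := visits (history_rev s) -oo%E +oo%E.

Lemma order_time_cons a s : uniq (a :: s) -> generic (a :: s) ->
  (order_time (a :: s) <= order_time s + 6 * (new_crossings a s + stale_crossings false a s +
     stale_crossings true a s + 2))%N.
Proof.
move=> /= /andP[as_ us] gs; rewrite /order_time /=.
apply: leq_trans (visits_insert _ _ _ _ _) _; rewrite leq_add2l leq_mul2l /=.
apply: hits_le => //; apply: good_history => //.
by apply: generic_sub gs => c cs; rewrite inE cs orbT.
Qed.

Lemma perm_sum_order_time s : uniq s -> generic s -> s != [::] ->
  (perm_sum s order_time <= \sum_(a <- s) perm_sum (rem a s) order_time +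
     6 * (sum_last new_crossings s + sum_last (stale_crossings false) s +
          sum_last (stale_crossings true) s + 2 * (size s)`!))%N.
Proof.
move=> us gs s0; rewrite perm_sum_cons //.
(* The constant is put in the form of the other terms, so that all split by the last curve. *)
have -> : (2 * (size s)`! = sum_last (fun _ _ => 2) s)%N.
  by rewrite -perm_sum_const // [LHS]perm_sum_cons.
rewrite /sum_last -!big_split /= big_distrr /= -big_split /=.
rewrite !big_seq; apply: leq_sum => a as_; rewrite -!perm_sumD.
rewrite {2}/perm_sum big_distrr /= -perm_sumD.
apply: perm_sum_le => t ts.
have p : perm_eq (a :: t) s.
  rewrite (perm_trans _ (_ : perm_eq (a :: rem a s) s)) ?perm_cons //.
  by rewrite perm_sym perm_to_rem.
apply: order_time_cons; first by rewrite (perm_uniq p).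
exact: generic_perm gs.
Qed.

(** * Harmonic bounds *)

Definition harmonic_number (n : nat) : R := \sum_(i < n) (i.+1%:R)^-1.

Lemma harmonic_numberS n : harmonic_number n.+1 = harmonic_number n + (n.+1%:R)^-1.
Proof. by rewrite /harmonic_number big_ord_recr. Qed.

Lemma harmonic_le n : harmonic_number n.+1 <= 1 + ln n.+1%:R.
Proof.
elim: n => [|n IH];
  first by rewrite harmonic_numberS /harmonic_number big_ord0 add0r invr1 ln1 addr0.
rewrite harmonic_numberS; set x : R := n.+2%:R.
have x2 : 1 < x by rewrite /x ltr1n.
have e : n.+1%:R = (1 - x^-1) * x :> R.
  by rewrite mulrBl mulVf ?mul1r; [rewrite /x -[n.+2]addn1 natrD addrK|lra].
have iv : x^-1 < 1 by rewrite invf_lt1 //; lra.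
have l : ln (n.+1%:R) = ln (1 - x^-1) + ln x.
  by rewrite e lnM // posrE; [rewrite subr_gt0|apply: lt_trans x2].
(* This makes the increment of the logarithm at least that of the harmonic number. *)
have : ln (1 - x^-1) <= - x^-1 by apply: le_ln1Dx; rewrite ltrN2.
move: IH; rewrite l; move: (x^-1) (ln (1 - _)) (ln x) (harmonic_number _) => *; lra.
Qed.

Lemma crossings_small s : (size s <= 1)%N -> crossings s = 0%N.
Proof.
move=> s1; rewrite /crossings big1 // => u _; apply/eqP; rewrite eqn0Ngt -has_count.
apply/hasPn => e _; apply/negP => ce; have lt := crosses_older ce.
have : (index e.1 s < size s)%N by rewrite index_mem; case/and5P: ce.
by move=> lt'; have := leq_trans (leq_ltn_trans (leq0n _) lt) (leq_trans lt' s1).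
Qed.

Lemma sum_rem_le s n (f : seq (curve R) -> nat) (k : R) :
  size s = n.+1 -> uniq s ->
  (forall a, a \in s -> (f (rem a s))%:R <= k * (n`!)%:R) ->
  (\sum_(a <- s) f (rem a s))%N%:R <= k * (n.+1`!)%:R.
Proof.
move=> Es us h; rewrite natr_sum.
apply: (@le_trans _ _ (\sum_(a <- s) k * (n`!)%:R)).
  by rewrite !big_seq; apply: ler_sum => a; exact: h.
rewrite big_const_seq count_predT iter_addr_0 Es factS natrM.
by rewrite -mulr_natr le_eqVlt; apply/orP; left; apply/eqP; ring.
Qed.

(** Here [q] is k, [p] is k - 1, [f] is k!, and [x], [y] are k! X(k), k! X(k-1). Eliminating the
    increment [z] gives X(k) / k <= X(k-1) / (k-1) + 4 / (k-1). *)
Lemma recurrence_step (p q x y z f h : R) : 0 < p -> q = p + 1 ->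
  x <= y + z -> q * z <= x + 4 * q * f -> y <= 4 * p * h * f ->
  x <= 4 * q * (h + p^-1) * f.
Proof.
move=> p0 eq h1 h2 h3; have q0 : 0 <= q by lra.
rewrite -(ler_pM2l p0).
have -> : p * (4 * q * (h + p^-1) * f) = q * (4 * p * h * f) + 4 * q * f.
  by field; rewrite lt0r_neq0.
have k1 : q * x <= q * (y + z) by rewrite ler_wpM2l.
have k2 : q * y <= q * (4 * p * h * f) by rewrite ler_wpM2l.
have k3 : p * x = q * x - x by rewrite eq; ring.
rewrite k3; move: k1 k2 h2; rewrite mulrDr.
by move: (q * (4 * p * h * f)) (q * x) (q * y) (q * z) (4 * q * f) => *; lra.
Qed.

Lemma perm_sum_crossings_le s : uniq s -> generic s ->
  (perm_sum s crossings)%:R <=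
    4 * (size s)%:R * harmonic_number (size s).-1 * ((size s)`!)%:R :> R.
Proof.
move: {2}(size s) (erefl (size s)) => n.
elim: n s => [|[|m] IH] s Es us gs.
- rewrite (perm_sum_eq (f' := fun=> 0%N)) => [|t ts].
    by rewrite perm_sum_const // mul0n Es mulr0 !mul0r.
  by rewrite crossings_small // (perm_size ts) Es.
(* A single curve is a separate base case, as the recurrence divides by k - 1. *)
- rewrite (perm_sum_eq (f' := fun=> 0%N)) => [|t ts].
    by rewrite perm_sum_const // mul0n Es /harmonic_number big_ord0 mulr0 !mul0r.
  by rewrite crossings_small // (perm_size ts) Es.
have s0 : s != [::] by rewrite -size_eq0 Es.
have h1 := perm_sum_crossings us s0; have h2 := sum_last_new us gs.
have h3 : (\sum_(a <- s) perm_sum (rem a s) crossings)%N%:R <=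
    4 * m.+1%:R * harmonic_number m * (m.+2`!)%:R :> R.
  apply: (@sum_rem_le _ _ (fun s => perm_sum s crossings)) => // a as_.
  have Er : size (rem a s) = m.+1 by rewrite size_rem // Es.
  have := IH (rem a s) Er (rem_uniq a us) (generic_sub (fun c => @mem_rem _ a s c) gs).
  by rewrite Er.
rewrite Es in h2 *; rewrite [m.+2.-1]/= harmonic_numberS.
have {}h1 : (perm_sum s crossings)%:R <=
    (\sum_(a <- s) perm_sum (rem a s) crossings)%N%:R + (sum_last new_crossings s)%:R :> R.
  by rewrite -natrD ler_nat.
have {}h2 : m.+2%:R * (sum_last new_crossings s)%:R <=
    (perm_sum s crossings)%:R + 4 * m.+2%:R * (m.+2`!)%:R :> R.
  by rewrite -[4]/(4%:R) -!natrM -natrD ler_nat.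
set X := (perm_sum s crossings)%:R in h1 h2 *; set F := (m.+2`!)%:R in h2 h3 *.
set SX := (_%N)%:R in h1 h3; set N := (sum_last _ s)%:R in h1 h2.
by apply: recurrence_step h1 h2 h3; rewrite ?ltr0n // -natr1.
Qed.

Lemma sum_last_new_le s n : uniq s -> generic s -> size s = n.+1 ->
  (sum_last new_crossings s)%:R <= (4 * harmonic_number n + 4) * (n.+1`!)%:R :> R.
Proof.
move=> us gs Es; have := sum_last_new us gs; have := perm_sum_crossings_le us gs.
rewrite Es [n.+1.-1]/=; move: (n.+1`!) => F h1; rewrite -(ler_nat R) natrD !natrM => h2.
have n0 : (0 : R) < n.+1%:R by rewrite ltr0n.
rewrite -(ler_pM2l n0); apply: (le_trans h2).
rewrite {h2 n0}; move: h1.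
by move: (perm_sum _ _)%:R (harmonic_number n) F%:R n.+1%:R => x h f q; lra.
Qed.

Lemma sum_last_stale_le b s n : uniq s -> generic s -> size s = n.+1 ->
  (sum_last (stale_crossings b) s)%:R <= 4 * harmonic_number n * (n.+1`!)%:R :> R.
Proof.
move=> us gs Es; have := sum_last_stale b us gs; have := perm_sum_crossings_le us gs.
rewrite Es [n.+1.-1]/=; move: (n.+1`!) => F h1; rewrite -(ler_nat R) !natrM => h2.
have n0 : (0 : R) < n.+1%:R by rewrite ltr0n.
rewrite -(ler_pM2l n0); apply: (le_trans h2).
rewrite {h2 n0}; move: h1.
by move: (perm_sum _ _)%:R (harmonic_number n) F%:R n.+1%:R => x h f q; lra.
Qed.

(** The 1 is the visit to the initial leaf. Each step costs at most 6 times (4 H + 4) + 4 H + 4 H +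
    2, which is 72 H + 36. *)
Lemma perm_sum_order_time_le s : uniq s -> generic s ->
  (perm_sum s order_time)%:R <=
    (1 + (size s)%:R * (72 * harmonic_number (size s) + 36)) * ((size s)`!)%:R :> R.
Proof.
move: {2}(size s) (erefl (size s)) => n.
elim: n s => [|n IH] s Es us gs.
  by move/size0nil: Es => ->; rewrite /perm_sum /= big_seq1 /order_time /= mul0r addr0 mulr1.
have s0 : s != [::] by rewrite -size_eq0 Es.
have := perm_sum_order_time us gs s0; rewrite Es => h1.
have h2 : (\sum_(a <- s) perm_sum (rem a s) order_time)%N%:R <=
    (1 + n%:R * (72 * harmonic_number n + 36)) * (n.+1`!)%:R :> R.
  apply: (@sum_rem_le _ _ (fun s => perm_sum s order_time)) => // a as_.
  have Er : size (rem a s) = n by rewrite size_rem // Es.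
  have := IH (rem a s) Er (rem_uniq a us) (generic_sub (fun c => @mem_rem _ a s c) gs).
  by rewrite Er.
have h3 := sum_last_new_le us gs Es.
have h4 := sum_last_stale_le false us gs Es.
have h5 := sum_last_stale_le true us gs Es.
move: h1; move: (n.+1`!) h2 h3 h4 h5 => F h2 h3 h4 h5.
rewrite -(ler_nat R) !(natrD, natrM) => h1; apply: (le_trans h1).
set SX := (_%N)%:R in h2 *.
apply: (@le_trans _ _ ((1 + n.+1%:R * (72 * harmonic_number n + 36)) * F%:R)).
  by move: h2 h3 h4 h5; rewrite -natr1; lra.
rewrite ler_wpM2r // lerD2l ler_wpM2l // lerD2r ler_wpM2l // harmonic_numberS.
by rewrite lerDl invr_ge0.
Qed.

(** * From lists of curves back to insertion orders *)

Lemma perm_sum_orders n (S : 'I_n -> curve R) (f : seq (curve R) -> nat) : injective S ->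
  (\sum_(s : {perm 'I_n}) f (rev [seq S (s i) | i <- enum 'I_n]))%N =
  perm_sum [seq S i | i <- enum 'I_n] f.
Proof.
move=> Sinj; pose o (s : {perm 'I_n}) := rev [seq S (s i) | i <- enum 'I_n].
have oE (s : {perm 'I_n}) : perm_eq (o s) [seq S i | i <- enum 'I_n].
  rewrite perm_rev (map_comp S s (enum 'I_n)); apply: perm_map.
  apply: uniq_perm; rewrite ?enum_uniq //.
    by rewrite map_inj_uniq ?enum_uniq //; exact: perm_inj.
  move=> i; rewrite mem_enum; apply/mapP; exists ((s^-1)%g i); rewrite ?mem_enum //.
  by rewrite permKV.
have oinj : injective o.
  move=> s s' /(congr1 rev); rewrite !revK => /eq_in_map h; apply/permP => i.
  by apply: Sinj; apply: h; rewrite mem_enum.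
rewrite -(big_map o xpredT f) /perm_sum; apply: perm_big.
have u1 : uniq (map o (index_enum {perm 'I_n})).
  by rewrite map_inj_uniq // index_enum_uniq.
apply: uniq_perm => //; first exact: permutations_uniq.
(* Injectivity of [S] makes the n! orders distinct as lists, so by counting they are all the
   rearrangements. *)
apply: (uniq_min_size u1 _ _).2.
  by move=> _ /mapP [s _ ->]; rewrite mem_permutations.
rewrite size_permutations; last by rewrite map_inj_uniq ?enum_uniq.
by rewrite (size_map S (enum 'I_n)) (size_map o) size_enum_ord -card_Sn
  -(sum1_size (index_enum _)) sum1_card.
Qed.

Lemma interior_disjoint_inj n (S : 'I_n -> curve R) : interior_disjoint S -> injective S.
Proof.
move=> dS i j E; apply/eqP/negPn/negP => /dS h.
have lt := xl_lt_xr (S i); pose x := (xl (S i) + xr (S i)) / 2.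
suff : (curve_interior (S i) `&` curve_interior (S j)) (x, height (S i) x) by rewrite h.
have hx : xl (S i) < x < xr (S i) by rewrite /x; lra.
by split; rewrite -?E; split.
Qed.

Lemma general_position_generic n (S : 'I_n -> curve R) :
  interior_disjoint S -> general_position S -> generic [seq S i | i <- enum 'I_n].
Proof.
move=> dS [g1 g2]; split.
  move=> [c b] [c' b'] /= /mapP [i _ ->] /mapP [j _ ->]; apply: (g1 i j).
    by case: b; [right|left].
  by case: b'; [right|left].
move=> _ _ x /mapP [i _ ->] /mapP [j _ ->] ij sx ix; apply/eqP => E.
have {}ij : i != j by apply: contraNneq ij => ->.
have jx : curve_interior (S j) (x, height (S i) x) by split.
(* Interior abscissae are excluded by disjointness; otherwise [x] is an end of [S i], which cannot
   lie inside [S j]. *)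
case: (boolP (inside (S i) x)) => [ii|]; last first.
  rewrite /inside negb_and -!leNgt; case/andP: sx => h1 h2 /orP[h|h]; apply: (g2 i j _ ij _ jx).
    by left; rewrite /lpoint; have -> : x = xl (S i) by lra.
  by right; rewrite /rpoint; have -> : x = xr (S i) by lra.
suff : (curve_interior (S i) `&` curve_interior (S j)) (x, height (S i) x) by rewrite dS.
by split => //; split.
Qed.

Lemma sum_verification_time_le n (S : 'I_n -> curve R) :
  interior_disjoint S -> general_position S ->
  \sum_(s : {perm 'I_n}) (verification_time (history S s))%:R <=
    (1 + n%:R * (72 * harmonic_number n + 36)) * (#|{perm 'I_n}|)%:R :> R.
Proof.
move=> dS gS; have Sinj := interior_disjoint_inj dS.
rewrite -natr_sum (perm_sum_orders order_time Sinj).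
apply: le_trans (perm_sum_order_time_le _ (general_position_generic dS gS)) _.
  by rewrite map_inj_uniq ?enum_uniq.
rewrite (size_map S (enum 'I_n)) size_enum_ord -card_Sn; exact: lexx.
Qed.

(** Here 109 = 1 + 72 + 36 collects the terms without logarithm, and dividing by [ln 2] absorbs them
    into n ln n for n at least 2. *)
Lemma nlogn_bound n : (1 < n)%N ->
  1 + n%:R * (72 * harmonic_number n + 36) <= (109 / ln 2 + 72) * (n%:R * ln n%:R) :> R.
Proof.
case: n => // n n1; have := harmonic_le n; set x : R := n.+1%:R => hx.
have x2 : 2 <= x by rewrite /x (ler_nat R 2).
have l2 : 0 < ln (2 : R) by rewrite ln_gt0 // ltr1n.
have lx : ln 2 <= ln x by rewrite ler_ln // posrE; lra.
have x0 : 0 <= x by lra.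
have k1 : x * (72 * harmonic_number n.+1 + 36) <= x * (72 * (1 + ln x) + 36).
  by rewrite ler_wpM2l // lerD2r ler_wpM2l.
have k2 : 109 <= 109 / ln 2 * ln x.
  by rewrite mulrAC ler_pdivlMr // ler_wpM2l.
have k3 : x * 109 <= x * (109 / ln 2 * ln x) by rewrite ler_wpM2l.
rewrite [X in _ <= X]mulrCA [X in _ <= x * X]mulrDl [X in _ <= X]mulrDr.
clear hx k2; move: k1 k3; clearbody x.
by move: (x * (109 / ln 2 * ln x)) (x * (72 * harmonic_number n.+1 + 36)) (ln x) => *; lra.
Qed.

End Geometry.

Theorem proposition14 (R : realType) :
  (exists K : R, forall (n : nat) (S : 'I_n -> curve R),
     (1 < n)%N -> interior_disjoint S -> general_position S ->
     order_mean (fun s => (verification_time (history S s))%:R)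
       <= K * (n%:R * ln n%:R))
  /\
  (forall C delta : R, 0 < delta ->
   exists K : R, forall (n : nat) (S : 'I_n -> curve R),
     (1 < n)%N -> interior_disjoint S -> general_position S ->
     let linear_size := fun s => (dag_size (history S s))%:R <= C * n%:R in
     delta <= order_prob R linear_size ->
     order_cond_mean linear_size
       (fun s => (verification_time (history S s))%:R)
       <= K * (n%:R * ln n%:R)).
Proof.
have Sn0 n : 0 < (#|{perm 'I_n}|)%:R :> R.
  by rewrite ltr0n; apply/card_gt0P; exists 1%g.
have mean n (S : 'I_n -> curve R) : (1 < n)%N -> interior_disjoint S -> general_position S ->
    order_mean (fun s => (verification_time (history S s))%:R)
      <= (109 / ln 2 + 72) * (n%:R * ln n%:R) :> R.
  move=> n1 dS gS; rewrite /order_mean ler_pdivrMr //.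
  apply: (le_trans (sum_verification_time_le dS gS)).
  by rewrite ler_wpM2r ?nlogn_bound // ltW.
split; first by exists (109 / ln 2 + 72).
(* Times are nonnegative, so the sum over the event is at most the sum over all orders; the event
   contains at least a fraction [delta] of them, hence the division by [delta]. *)
move=> C delta d0; exists ((109 / ln 2 + 72) / delta) => n S n1 dS gS A hA.
have A0 : 0 < (#|A|)%:R :> R.
  have := lt_le_trans d0 hA; rewrite /order_prob.
  by rewrite pmulr_lgt0 ?invr_gt0.
rewrite /order_cond_mean ler_pdivrMr //.
apply: (@le_trans _ _ (\sum_s (verification_time (history S s))%:R)).
  rewrite [X in _ <= X](bigID A) /= lerDl.
  by apply: sumr_ge0 => s _.
have := mean n S n1 dS gS; rewrite /order_mean ler_pdivrMr // => /le_trans; apply.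
move: hA; rewrite /order_prob ler_pdivlMr // => hA.
have k0 : 0 <= (109 / ln 2 + 72) * (n%:R * ln n%:R) :> R.
  rewrite mulr_ge0 ?addr_ge0 ?divr_ge0 ?mulr_ge0 ?ln_ge0 ?ler1n //.
  exact: ltnW.
rewrite [X in _ <= X * _]mulrAC -[X in _ <= X]mulrA ler_wpM2l //.
by rewrite mulrC ler_pdivlMr // mulrC.
Qed.
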